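(* Suppose that conditions (C1), (C2) and (C3) (stated in the context) hold. (1) For any $\mu\in\mathfrak{N}^{\circ}(\mathbb{R})$, there exists a unique probability measure $\mathbf{Q}_{\infty}$ on $\mathfrak{N}^{\circ}(\mathbb{R})$ such that $$\lim_{n\to\infty}\lim_{l\to\infty}\mathbb{P}_{\mu}(Z_n\in\cdot\mid N_{n+l}>0)=\mathbf{Q}_{\infty}(\cdot)$$ in the sense of weak convergence, and its Laplace functional satisfies $$L_{\mathbf{Q}_{\infty}}[h]=\varphi(0)\int_{\mathfrak{N}^{\circ}(\mathbb{R})}\nu(\mathbb{R})\,\mathrm{e}^{-\nu(h)}\,\mathbf{Q}_{\rm min}(\mathrm{d}\nu),\quad h\in\mathcal{B}_b^+(\mathbb{R}),$$ where $\varphi(0)=\lim_{n\to\infty}(1-f_n(0))/m^n$ and $\mathbf{Q}_{\rm min}$ is the Yaglom limit. (2) For any $\mu\in\mathfrak{N}^{\circ}(\mathbb{R})$, $$\lim_{l\to\infty}\lim_{n\to\infty}\mathbb{P}_{\mu}(Z_n\in\cdot\mid N_{n+l}>0)=\mathbf{Q}_{\infty}(\cdot)$$ in the sense of weak convergence, where $\mathbf{Q}_{\infty}$ is the measure in (1).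
   Context: Let $\mathbb{N}=\{0,1,2,\dots\}$. Let $p=\{p_j\}_{j\in\mathbb{N}}$ be a probability measure on $\mathbb{N}$ (offspring distribution) with mean $m=\sum_j jp_j$ and generating function $f(s)=\sum_jp_js^j$; $f_0(s)=s$, $f_n=f\circ f_{n-1}$. The limit $\varphi(0)$ exists. Let $P$ be a transition probability (Markov kernel) on $\mathbb{R}$, with $n$-step transition probability $P_n$; write $P_nh(x)=\int h(y)P_n(x,\mathrm{d}y)$. $\mathfrak{N}(\mathbb{R})$ is the space of finite integer-valued Borel measures (finite point measures) on $\mathbb{R}$ with the topology of weak convergence, $\mathbf{0}$ the null measure, $\mathfrak{N}^{\circ}(\mathbb{R})=\mathfrak{N}(\mathbb{R})\setminus\{\mathbf{0}\}$. $\mathcal{B}_b^+(\mathbb{R})$ is the set of bounded nonnegative Borel functions on $\mathbb{R}$. Branching Markov chain: under $\mathbb{P}_{\delta_x}$, generation $0$ consists of one particle at $x$. Each particle of generation $n$, independently of the others of its generation, is replaced after one unit of time by a random number of children with law $p$; given that the parent is at $y$, the children are positioned independently according to $P(y,\cdot)$; they form generation $n+1$. For $\mu=\sum_i\delta_{x_i}\in\mathfrak{N}^\circ(\mathbb{R})$, under $\mathbb{P}_\mu$ the system is the union of independent branching Markov chains started from single particles at the $x_i$. $Z_n$ is the counting measure on $\mathbb{R}$ of the positions of the particles of generation $n$, and $N_n=Z_n(\mathbb{R})$. Conditions. (C1): $0<m<1$ and $p$ has finite moments of all orders. (C2): $\limsup_{n\to\infty}(p_n)^{1/n}\in[0,1)$.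 (C3): there exists a probability measure $\pi$ on $\mathbb{R}$ such that $P_nh(x)\to\pi(h):=\int h\,\mathrm{d}\pi$ as $n\to\infty$ for every $x\in\mathbb{R}$ and every $h\in\mathcal{B}_b^+(\mathbb{R})$. Yaglom limit: under (C1)–(C3) there is a unique probability measure $\mathbf{Q}_{\rm min}$ on $\mathfrak{N}^{\circ}(\mathbb{R})$ such that $\mathbb{P}_\mu(Z_n\in\cdot\mid N_n>0)\to\mathbf{Q}_{\rm min}$ weakly as $n\to\infty$ for every $\mu\in\mathfrak{N}^\circ(\mathbb{R})$. Laplace functional of a probability measure $\mathbf{Q}$ on $\mathfrak{N}(\mathbb{R})$ (or $\mathfrak{N}^\circ(\mathbb{R})$): $L_{\mathbf{Q}}[h]=\int\mathrm{e}^{-\mu(h)}\,\mathbf{Q}(\mathrm{d}\mu)$, $\mu(h)=\int h\,\mathrm{d}\mu$. An iterated limit of measures means that for each fixed value of the outer index the inner weak limit exists (as a probability measure on $\mathfrak{N}^\circ(\mathbb{R})$), and these inner limits converge weakly along the outer index. *)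

(* Defs.v *)
From HB Require Import structures.
From mathcomp Require Import all_boot all_order all_algebra.
From mathcomp Require Import all_classical all_reals all_analysis.
From mathcomp Require Import measurable_realfun giry lra.

Set Implicit Arguments.
Unset Strict Implicit.
Unset Printing Implicit Defensive.
Import Order.TTheory GRing.Theory Num.Theory.
Import numFieldNormedType.Exports.

Local Open Scope classical_set_scope.
Local Open Scope ring_scope.
Local Open Scope ereal_scope.

(* A measure is a total function [set T -> \bar R], so two equal Borel
   measures may still differ as terms on non-measurable sets; equality of
   (random) measures is always meant as agreement on measurable sets. *)

Record pointMeasure (R : realType) := PointMeasure {
  pm_measure :> {measure set R -> \bar R};
  pm_natural : forall A, measurable A -> exists k : nat, pm_measure A = k%:R%:E }.

HB.instance Definition _ (R : realType) := gen_eqMixin (pointMeasure R).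
HB.instance Definition _ (R : realType) := gen_choiceMixin (pointMeasure R).

Section point_measures.
Context {R : realType}.

Definition diracs (s : seq R) : {measure set R -> \bar R} :=
  msum (fun i => \d_(nth 0%R s i)) (size s).

Lemma diracsE (s : seq R) (A : set R) : diracs s A = \sum_(x <- s) \d_x A.
Proof. by rewrite (big_nth 0%R) big_mkord. Qed.

Lemma diracs_natural (s : seq R) (A : set R) : measurable A ->
  exists k : nat, diracs s A = k%:R%:E.
Proof.
move=> _; rewrite diracsE; exists (\sum_(x <- s) (x \in A))%N.
rewrite natr_sum -sumEFin; apply: eq_bigr => x _; exact: diracE.
Qed.

Definition pm_mass (nu : pointMeasure R) : \bar R := nu [set: R].

Definition pm_int (nu : pointMeasure R) (h : R -> R) : R := (\int[nu]_x h x)%R.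

Definition pointSum (s : seq R) : pointMeasure R :=
  PointMeasure (@diracs_natural s).

End point_measures.

HB.instance Definition _ (R : realType) :=
  isPointed.Build (pointMeasure R) (pointSum [::]).

Section weak_topology.
Context {R : realType}.

Definition boundedContinuous := {f : R -> R | continuous f /\ bounded_fun f}.

Definition pairing (nu : pointMeasure R) : {ptws boundedContinuous -> R} :=
  fun f => pm_int nu (sval f).

End weak_topology.

(* Topology of weak convergence: the coarsest one for which
   [nu |-> \int[nu]_x f x] is continuous for all bounded continuous [f]. *)
HB.instance Definition _ (R : realType) :=
  Topological.copy (pointMeasure R) (initial_topology (@pairing R)).

Definition nzPointMeasure (R : realType) : Type :=
  set_type [set nu : pointMeasure R | nu [set: R] != 0].

HB.instance Definition _ (R : realType) :=
  Topological.copy (nzPointMeasure R)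
    (set_type [set nu : pointMeasure R | nu [set: R] != 0]).

Definition nzpm_val (R : realType) (nu : nzPointMeasure R) : pointMeasure R :=
  set_val nu.
Coercion nzpm_val : nzPointMeasure >-> pointMeasure.

Lemma pointSum1_neq0 (R : realType) :
  (pointSum [:: 0%R] : pointMeasure R) [set: R] != 0.
Proof. by rewrite /= diracsE big_seq1 diracT oner_neq0. Qed.

HB.instance Definition _ (R : realType) :=
  isPointed.Build (nzPointMeasure R) 
    (exist _ (pointSum [:: 0%R]) (mem_set (@pointSum1_neq0 R))).

Section borel.
Context {R : realType}.

Definition borel : set (set (nzPointMeasure R)) :=
  <<s (@open (nzPointMeasure R)) >>.

Let borel0 : borel set0. Proof. exact: sigma_algebra0. Qed.

Let borelC (A : set (nzPointMeasure R)) : borel A -> borel (~` A).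
Proof. exact: sigma_algebraC. Qed.

Let borelU (F : (set (nzPointMeasure R))^nat) :
  (forall i, borel (F i)) -> borel (\bigcup_i F i).
Proof. exact: sigma_algebra_bigcup. Qed.

Definition borel_display : measure_display.
Proof. by constructor. Qed.

HB.instance Definition _ :=
  @isMeasurable.Build borel_display (nzPointMeasure R) borel borel0 borelC borelU.

End borel.

Definition weak_cvg (R : realType) (Q_ : nat -> probability (nzPointMeasure R) R)
    (Q : probability (nzPointMeasure R) R) : Prop :=
  forall F : nzPointMeasure R -> R, continuous F -> bounded_fun F ->
    (\int[Q_ n]_nu F nu)%R @[n --> \oo] --> (\int[Q]_nu F nu)%R.

Definition iterated_weak_cvg (R : realType)
    (Q_ : nat -> nat -> probability (nzPointMeasure R) R)
    (Q : probability (nzPointMeasure R) R) : Prop :=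
  exists Qin : nat -> probability (nzPointMeasure R) R,
    (forall i, weak_cvg (Q_ i) (Qin i)) /\ weak_cvg Qin Q.

Section offspring_law.
Context {R : realType} (p : probability nat R).

Definition pmf (j : nat) : R := fine (p [set j]).

Definition mean : \bar R := \sum_(j <oo) (j%:R * pmf j)%:E.

Definition genfun (s : R) : R := limn (series (fun j => pmf j * s ^+ j)%R).

Definition phi0 : R :=
  limn (fun n => (1 - iter n genfun 0) / fine mean ^+ n)%R.

Definition condC1 : Prop :=
  (0 < mean < 1) /\ forall k, \sum_(j <oo) (j%:R ^+ k * pmf j)%:E < +oo.

Definition condC2 : Prop :=
  0 <= limn_esup (fun n => (pmf n `^ n%:R^-1)%:E) < 1.

End offspring_law.

Section motion.
Context {R : realType}.

Definition bdd_borel_nonneg (h : R -> R) : Prop :=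
  [/\ measurable_fun [set: R] h, bounded_fun h & forall x, (0 <= h x)%R].

Fixpoint nstep (P : R.-pker R ~> R) (n : nat) : R.-spker R ~> R :=
  if n is n'.+1 then mkcomp_noparam P (nstep P n')
  else kdirac (@measurable_id _ R [set: R]).

Definition condC3 (P : R.-pker R ~> R) : Prop :=
  exists pi : probability R R, forall (x : R) (h : R -> R),
    bdd_borel_nonneg h ->
    \int[nstep P n x]_y (h y)%:E @[n --> \oo] --> \int[pi]_y (h y)%:E.

End motion.

(* Ulam-Harris labels of potential particles: [(i, w)] descends from the
   [i]-th initial particle, and [w] lists the birth ranks along its ancestral
   line, most recent birth first; its generation is [size w]. *)
Definition label : Type := (nat * seq nat)%type.
Definition generation (v : label) : nat := size v.2.
Definition child (v : label) (j : nat) : label := (v.1, j :: v.2).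

Section genealogy.
Context d (Omega : measurableType d) (R : realType).
Variables (pos : label -> {mfun Omega >-> R})
  (offspring : label -> {mfun Omega >-> nat}).

(* Generated by the positions up to generation [n] and the offspring numbers
   of the generations before [n]. *)
Definition history (n : nat) : set (set Omega) :=
  <<s (\bigcup_(v in [set v | (generation v <= n)%N])
        preimage_set_system [set: Omega] (pos v) measurable) `|`
      (\bigcup_(v in [set v | (generation v < n)%N])
        preimage_set_system [set: Omega] (offspring v) measurable) >>.

Fixpoint population (k n : nat) (w : Omega) : seq label :=
  if n is n'.+1 then
    [seq child v j | v <- population k n' w, j <- iota 0 (offspring v w)]
  else [seq (i, [::]) | i <- iota 0 k].

End genealogy.

(* A realization of P_mu. Every label carries a position and an offspring
   number; only those of labels in [population] belong to actual particles. *)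
Record branchingChain (R : realType) (p : probability nat R)
    (P : R.-pker R ~> R) (mu : nzPointMeasure R) := BranchingChain {
  bc_display : measure_display;
  bc_space : measurableType bc_display;
  bc_prob : probability bc_space R;
  bc_atoms : seq R;
  bc_pos : label -> {mfun bc_space >-> R};
  bc_offspring : label -> {mfun bc_space >-> nat};
  bc_atomsP : forall A, measurable A -> mu A = pointSum bc_atoms A;
  bc_root : forall i w, (i < size bc_atoms)%N ->
    bc_pos (i, [::]) w = nth 0%R bc_atoms i;
  (* Given the history up to generation [n], the particles of generation [n]
     reproduce independently: [v] has [k] children with probability [pmf p k],
     whose positions are then independent with law [P (bc_pos v)]. *)
  bc_branching : forall (n : nat) (E : set bc_space) (s : seq label)
      (k : label -> nat) (B : label -> nat -> set R),
    history bc_pos bc_offspring n E ->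
    uniq s -> (forall v, v \in s -> generation v = n) ->
    (forall v j, measurable (B v j)) ->
    bc_prob (E `&` [set w | forall v, v \in s -> bc_offspring v w = k v /\
       forall j, (j < k v)%N -> B v j (bc_pos (child v j) w)]) =
    \int[bc_prob]_(w in E) (\prod_(v <- s)
       (pmf p (k v) * \prod_(j < k v) fine (P (bc_pos v w) (B v j))))%:E }.

Section branching_chain.
Context {R : realType} {p : probability nat R} {P : R.-pker R ~> R}.
Context {mu : nzPointMeasure R} (X : branchingChain p P mu).

Definition config (n : nat) (w : bc_space X) : pointMeasure R :=
  pointSum [seq bc_pos X v w |
    v <- population (bc_offspring X) (size (bc_atoms X)) n w].

Definition alive (n : nat) : set (bc_space X) :=
  [set w | 0 < config n w [set: R]].

End branching_chain.
Arguments config {R p P mu} X n w.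
Arguments alive {R p P mu} X n.

Lemma pairing_pointSum (R : realType) (s : seq R) (f : @boundedContinuous R) :
  pairing (pointSum s) f = (\sum_(i < size s) sval f (nth 0 s i))%R.
Proof.
case: f => f [cf bf]; rewrite /pairing /pm_int /Rintegral /=.
have /measurable_EFinP mf := continuous_measurable_fun cf.
rewrite integralE.
rewrite (@ge0_integral_measure_sum _ _ _ _ _ _ ((fun x => (f x)%:E)^\+)) //;
  last exact: measurable_funepos.
rewrite (@ge0_integral_measure_sum _ _ _ _ _ _ ((fun x => (f x)%:E)^\-)) //;
  last exact: measurable_funeneg.
rewrite (eq_bigr (fun i : 'I_(size s) => (Num.max (f s`_i) 0)%:E)); last first.
  move=> i _; rewrite integral_dirac//; last exact: measurable_funepos.
  by rewrite diracT mul1e funeposE EFin_max.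
rewrite [X in _ - X](eq_bigr (fun i : 'I_(size s) => (Num.max (- f s`_i) 0)%:E));
    last first.
  move=> i _; rewrite integral_dirac//; last exact: measurable_funeneg.
  by rewrite diracT mul1e funenegE EFin_max.
rewrite !sumEFin -EFinB /= -sumrB; apply: eq_bigr => i _.
by case: (leP (f s`_i) 0%R); case: (leP (- f s`_i)%R 0%R) => *; lra.
Qed.

Section pointSum_continuous.
Context {R : realType}.
Definition seq_ball (s : seq R) (e : R) : set (seq R) :=
  [set t | size t = size s /\ forall i, (i < size s)%N -> (`|nth 0 s i - nth 0 t i| < e)%R].

Definition seq_nbhs (s : seq R) : set_system (seq R) :=
  filter_from [set e : R | (0 < e)%R] (seq_ball s).

#[local] Instance seq_nbhs_filter s : Filter (seq_nbhs s).
Proof.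
apply: filter_from_filter; first by exists 1%R => /=; exact: ltr01.
move=> e1 e2 /= e10 e20; exists (Num.min e1 e2); first by rewrite /= lt_min e10.
move=> t [ts st]; split; split=> // i /st; by rewrite lt_min => /andP[].
Qed.

Lemma pointSum_cvg (s : seq R) : pointSum @ seq_nbhs s --> pointSum s.
Proof.
have H : ((@pairing R) \o pointSum) @ seq_nbhs s --> pairing (pointSum s).
  apply/cvg_sup => f U [V [[W oW <-] Wf] WU].
  suff : (fun t => pairing (pointSum t) f) @ seq_nbhs s --> pairing (pointSum s) f.
    move=> /(_ W (open_nbhs_nbhs (conj oW Wf))).
    move=> sW; apply: (@filterS _ (seq_nbhs s) _ _ _ _ sW) => t; exact: WU.
  rewrite pairing_pointSum.
  apply: (@cvg_trans _ ((fun t : seq R => (\sum_(i < size s) sval f (nth 0 t i))%R) @ seq_nbhs s)).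
    apply: near_eq_cvg; exists 1%R; first exact: ltr01.
    by move=> t [ts _] /=; rewrite pairing_pointSum ts.
  apply: cvg_big => [|i _]; first exact: add_continuous.
  apply: (@cvg_comp _ _ _ (fun t : seq R => nth 0%R t i)); last exact: (svalP f).1.
  apply/cvgrPdist_lt => e e0; exists e => // t [_ ]; exact.
move=> U /= [V [[W oW <-] Ws WU]].
have sW := H W (open_nbhs_nbhs (conj oW Ws)).
apply: (@filterS _ (seq_nbhs s) _ _ _ _ sW) => t; exact: WU.
Qed.


End pointSum_continuous.

Lemma bigcup_countType_measurable d (Omega : measurableType d) (C : countType)
    (D : set C) (F : C -> set Omega) :
  (forall c, measurable (F c)) -> measurable (\bigcup_(c in D) F c).
Proof.
move=> mF; pose G n := if unpickle n is Some c
  then (if `[< D c >] then F c else set0) else set0.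
rewrite (_ : \bigcup_(c in D) F c = \bigcup_n G n); last first.
  apply/seteqP; split => [w [c Dc Fc]|w [n _]].
    by exists (pickle c) => //; rewrite /G pickleK; case: asboolP.
  by rewrite /G; case: unpickle => // c; case: asboolP => // Dc; exists c.
apply: bigcup_measurable => n _; rewrite /G.
by case: unpickle => // c; case: asboolP.
Qed.

Section config_measurable.
Context d (Omega : measurableType d) (R : realType).
Variables (x : label -> {mfun Omega >-> R}) (nu : label -> {mfun Omega >-> nat}).

Lemma measurable_pointSum (L : seq label) (U : set (pointMeasure R)) : open U ->
  measurable [set w | U (pointSum [seq x v w | v <- L])].
Proof.
move=> oU.
pose good (q : seq rat * nat) :=
  seq_ball (map ratr q.1) (q.2.+1%:R^-1) `<=` (@pointSum R) @^-1` U.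
rewrite (_ : [set _ | _] = \bigcup_(q in good)
    [set w | seq_ball (map ratr q.1) q.2.+1%:R^-1 [seq x v w | v <- L]]).
  apply: bigcup_countType_measurable => -[q m] /=.
  have [Lq|Lq] := eqVneq (size L) (size q); last first.
    rewrite (_ : [set _ | _] = set0)// -subset0 => w [].
    by rewrite !size_map => /eqP; rewrite (negbTE Lq).
  rewrite (_ : [set _ | _] = \bigcap_(i in [set i | (i < size q)%N])
     ((x (nth (0%N, [::]) L i)) @^-1`
        [set` Interval (BRight (ratr (nth 0%R q i) - m.+1%:R^-1)%R)
                   (BLeft (ratr (nth 0%R q i) + m.+1%:R^-1)%R)])); last first.
    apply/seteqP; split => w; rewrite /seq_ball /= !size_map.
      move=> [_ H] i /= iq; have := H i iq.
      rewrite (nth_map 0%R)// (nth_map (0%N, [::])) ?Lq//.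
      by rewrite in_itv/= -ltr_distlC.
    move=> H; split=> // i iq; have := H i iq.
    rewrite (nth_map 0%R)// (nth_map (0%N, [::])) ?Lq//.
    by rewrite /= in_itv/= -ltr_distlC.
  apply: bigcap_measurableType => i _.
  rewrite -[X in measurable X]setTI.
  exact: (measurable_funPT (x _)).
apply/seteqP; split => [w /= Uw|w [q gq]/gq//].
set s := [seq _ | _ <- _] in Uw *.
have [e /= e0 sU] := @pointSum_cvg R s U (open_nbhs_nbhs (conj oU Uw)).
have [m me] : exists m : nat, (m.+1%:R^-1 < e / 2)%R.
  have e20 : (0 < e / 2)%R by rewrite divr_gt0.
  have [m _ /(_ m (leqnn m))] := near_infty_natSinv_lt (PosNum e20).
  by exists m.
have ex i : exists q : rat, (`|ratr q - nth 0 s i| < m.+1%:R^-1)%R.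
  have /rat_in_itvoo[q] : (nth 0 s i - m.+1%:R^-1 < nth 0 s i + m.+1%:R^-1)%R.
    by rewrite ltrD2l gt0_cp// invr_gt0.
  by rewrite in_itv/= => qs; exists q; rewrite distrC ltr_distlC.
have [q qs] := choice ex.
exists (mkseq q (size s), m) => /=; last first.
  split; first by rewrite !size_map size_iota.
  move=> i; rewrite !size_map size_iota => iL; rewrite (nth_map 0%R) ?size_mkseq ?size_map//.
  by rewrite nth_mkseq ?size_map.
move=> t [ts st]; apply: sU; split.
  by rewrite ts !size_map size_iota.
move=> i iL; have := st i; rewrite size_map size_mkseq => /(_ iL).
rewrite (nth_map 0%R) ?size_mkseq// nth_mkseq// => H1.
rewrite (splitr e) (le_lt_trans (ler_distD (ratr (q i)) _ _))// ltrD//.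
  by rewrite distrC (lt_trans (qs i)).
exact: lt_trans H1 me.
Qed.

Lemma measurable_offspring_map (M : seq label) (l : seq nat) :
  measurable [set w | [seq nu v w | v <- M] = l].
Proof.
elim: M l => [|v M IH] [|k l] /=.
- by rewrite (_ : [set _ | _] = setT)//; apply/seteqP; split.
- by rewrite (_ : [set _ | _] = set0)// -subset0.
- by rewrite (_ : [set _ | _] = set0)// -subset0.
- rewrite (_ : [set _ | _] = nu v @^-1` [set k] `&`
      [set w | [seq nu v w | v <- M] = l]); last first.
    by apply/seteqP; split => w /= => [[]|[-> ->]].
  apply: measurableI => //.
  rewrite -[X in measurable X]setTI.
  exact: (measurable_funPT (nu v)).
Qed.

Lemma measurable_population (k n : nat) (L : seq label) :
  measurable [set w | population nu k n w = L].
Proof.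
elim: n L => [|n IH] L /=.
  have [H|H] := pselect ([seq (i, [::]) | i <- iota 0 k] = L).
    by rewrite (_ : [set _ | _] = setT)//; apply/seteqP; split.
  by rewrite (_ : [set _ | _] = set0)// -subset0 => w /=.
pose kids (M : seq label) (l : seq nat) :=
  flatten [seq [seq child q.1 j | j <- iota 0 q.2] | q <- zip M l].
rewrite (_ : [set _ | _] = \bigcup_(q in [set q | kids q.1 q.2 = L])
   ([set w | population nu k n w = q.1] `&`
    [set w | [seq nu v w | v <- q.1] = q.2])).
  apply: bigcup_countType_measurable => -[M l] /=.
  by apply: measurableI => //; exact: measurable_offspring_map.
have kidsE M w : kids M [seq nu v w | v <- M] =
    [seq child v j | v <- M, j <- iota 0 (nu v w)].
  by elim: M => //= v M; rewrite /kids /= => ->.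
apply/seteqP; split => [w /= wL|w [[M l] /= <- [<- <-]]]; last by rewrite kidsE.
exists (population nu k n w, [seq nu v w | v <- population nu k n w]) => //=.
by rewrite kidsE.
Qed.

Lemma measurable_config (k n : nat) (U : set (pointMeasure R)) : open U ->
  measurable [set w | U (pointSum [seq x v w | v <- population nu k n w])].
Proof.
move=> oU.
rewrite (_ : [set _ | _] = \bigcup_(L in setT)
   ([set w | population nu k n w = L] `&`
    [set w | U (pointSum [seq x v w | v <- L])])).
  apply: bigcup_countType_measurable => L; apply: measurableI.
    exact: measurable_population.
  exact: measurable_pointSum.
apply/seteqP; split => [w /= ?|w [L _ [/= -> //]]].
by exists (population nu k n w).
Qed.

Lemma measurable_config_gt0 (k n : nat) :
  measurable [set w |
    0 < pointSum [seq x v w | v <- population nu k n w] [set: R]].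
Proof.
rewrite (_ : [set _ | _] = \bigcup_(L in [set L | L != [::]])
   [set w | population nu k n w = L]).
  by apply: bigcup_countType_measurable => L; exact: measurable_population.
have E w : (0 < pointSum [seq x v w | v <- population nu k n w] [set: R]) =
    (population nu k n w != [::]).
  rewrite /= diracsE; under eq_bigr do rewrite diracT.
  by rewrite sumEFin big_const_seq count_predT iter_addr_0 lte_fin ltr0n size_map lt0n size_eq0.
apply/seteqP; split => [w H|w [L /= L0 wL]].
  by exists (population nu k n w) => //; rewrite /mkset -E.
by rewrite /mkset E wL.
Qed.

End config_measurable.

Section conditional_law.
Context {R : realType} {p : probability nat R} {P : R.-pker R ~> R}.
Context {mu : nzPointMeasure R} (X : branchingChain p P mu).

Lemma nzpm_val_inj : injective (@nzpm_val R).
Proof. exact: val_inj. Qed.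

Lemma measurable_alive (n : nat) : measurable (alive X n).
Proof. exact: measurable_config_gt0. Qed.

Lemma alive_nz (n : nat) :
  alive X n = config X n @^-1` (@nzpm_val R @` [set: nzPointMeasure R]).
Proof.
apply/seteqP; split => w /=; rewrite /alive /mkset.
  rewrite lt0e => /andP[Z0 _].
  by exists (exist _ (config X n w) (mem_set Z0)).
case=> nu _ <-; rewrite lt0e measure_ge0 andbT; exact: (set_mem (valP nu)).
Qed.

Lemma measurable_config_nz (n : nat) (B : set (nzPointMeasure R)) :
  measurable B -> measurable (config X n @^-1` (@nzpm_val R @` B)).
Proof.
pose G := [set B : set (nzPointMeasure R) |
  measurable (config X n @^-1` (@nzpm_val R @` B))].
suff : borel `<=` G by exact.
apply: smallest_sub.
  split.
  - by rewrite /G /= image_set0 preimage_set0.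
  - move=> A; rewrite /G /= => mA.
    rewrite (_ : _ @^-1` _ =
        alive X n `\` config X n @^-1` (@nzpm_val R @` A)).
      by apply: measurableD => //; exact: measurable_alive.
    rewrite alive_nz; apply/seteqP; split => w.
      move=> [nu [_ nA] nuw]; split; first by exists nu.
      by move=> [nu' An' n'w]; apply: nA; rewrite -(nzpm_val_inj (etrans n'w (esym nuw))).
    move=> [[nu _ nuw] nA]; exists nu => //; split=> // Anu.
    by apply: nA; exists nu.
  - move=> F; rewrite /G /= => mF.
    by rewrite image_bigcup preimage_bigcup; exact: bigcup_measurable.
move=> A [U oU <-]; rewrite /G /=.
rewrite (_ : _ @^-1` _ = alive X n `&` config X n @^-1` U).
  by apply: measurableI; [exact: measurable_alive|exact: measurable_config].
rewrite alive_nz; apply/seteqP; split => w.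
  by move=> [nu Unu nuw]; split; [exists nu|rewrite /= -nuw].
by move=> [[nu _ nuw]]; rewrite /preimage /= -nuw => Unu; exists nu.
Qed.

(* P_mu(Z_n \in B, N_(n+l) > 0) *)
Definition aliveLaw (n l : nat) (B : set (nzPointMeasure R)) : \bar R :=
  bc_prob X ((config X n @^-1` (@nzpm_val R @` B)) `&` alive X (n + l)).

Let aliveLaw0 n l : aliveLaw n l set0 = 0.
Proof. by rewrite /aliveLaw image_set0 preimage_set0 set0I measure0. Qed.

Let aliveLaw_ge0 n l B : 0 <= aliveLaw n l B.
Proof. exact: measure_ge0. Qed.

Let aliveLaw_sigma_additive n l : semi_sigma_additive (aliveLaw n l).
Proof.
move=> F mF tF mUF; rewrite /aliveLaw image_bigcup preimage_bigcup setI_bigcupl.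
apply: measure_semi_sigma_additive.
- move=> i; apply: measurableI; last exact: measurable_alive.
  exact: measurable_config_nz.
- apply/trivIsetP => i j _ _ ij; rewrite -subset0 => w.
  move=> [[[nu Fi nuw] _] [[nu' Fj nu'w] _]].
  have /trivIsetP/(_ i j I I ij) Fij := tF.
  suff : (F i `&` F j) nu by rewrite Fij.
  by split=> //; rewrite (nzpm_val_inj (etrans nuw (esym nu'w))).
- apply: bigcup_measurable => i _.
  apply: measurableI; last exact: measurable_alive.
  exact: measurable_config_nz.
Qed.

HB.instance Definition _ n l := isMeasure.Build _ _ _ (aliveLaw n l)
  (aliveLaw0 n l) (aliveLaw_ge0 n l) (@aliveLaw_sigma_additive n l).

(* P_mu(Z_n \in B | N_(n+l) > 0); the Dirac measure is only used if the
   conditioning event is negligible. *)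
Definition condLaw (n l : nat) : probability (nzPointMeasure R) R :=
  mnormalize (aliveLaw n l) \d_(point : nzPointMeasure R).

Lemma alive_decr (n l : nat) : alive X (n + l) `<=` alive X n.
Proof.
have E k w : alive X k w =
    (population (bc_offspring X) (size (bc_atoms X)) k w != [::]).
  rewrite /alive /mkset /config /= diracsE.
  under eq_bigr do rewrite diracT.
  by rewrite sumEFin big_const_seq count_predT iter_addr_0 lte_fin ltr0n
    size_map lt0n size_eq0.
move=> w; rewrite !E; apply: contra => /eqP pn0.
by elim: l => [|l /eqP IH]; rewrite ?addn0 ?pn0// addnS /= IH.
Qed.

Lemma aliveLawT (n l : nat) :
  aliveLaw n l [set: nzPointMeasure R] = bc_prob X (alive X (n + l)).
Proof.
by rewrite /aliveLaw -alive_nz (setIidr (@alive_decr n l)).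
Qed.

End conditional_law.

(* X plays the role of the family (P_mu). *)
Definition yaglom_limit (R : realType) (p : probability nat R)
    (P : R.-pker R ~> R) (X : forall mu : nzPointMeasure R, branchingChain p P mu)
    (Q : probability (nzPointMeasure R) R) : Prop :=
  forall mu, weak_cvg (fun n => condLaw (X mu) n 0) Q.

Definition laplace (R : realType) (Q : probability (nzPointMeasure R) R)
    (h : R -> R) : \bar R :=
  \int[Q]_nu (expR (- pm_int (nzpm_val nu) h))%:E.

(* Main.v *)
Require Import Defs.
From HB Require Import structures.
From mathcomp Require Import all_boot all_order all_algebra.
From mathcomp Require Import all_classical all_reals all_analysis.
From mathcomp Require Import measurable_realfun giry.

Set Implicit Arguments.
Unset Strict Implicit.
Unset Printing Implicit Defensive.
Import Order.TTheory GRing.Theory Num.Theory.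
Import numFieldNormedType.Exports.

Local Open Scope classical_set_scope.
Local Open Scope ring_scope.
Local Open Scope ereal_scope.
From mathcomp Require Import ring lra zify.

(** Write [q_n = 1 - f_n(0)], [k = mu(R)], and [r_n = 1 - (1 - q_n)^k] for the
    survival probability up to generation [n] under [P_mu].  By the branching
    property a configuration [nu] of generation [n] has descendants in
    generation [n + l] with probability [H_l(nu) = 1 - (1 - q_l)^(nu(R))], so
    the law of [Z_n] given [N_(n+l) > 0] has density [(r_n / r_(n+l)) H_l] with
    respect to the law [Y_n] of [Z_n] given [N_n > 0].  Since [q_n / m^n]
    decreases to [phi(0)], which is positive because [p] has a second moment,
    and since [H_l(nu) / q_l] increases to [nu(R)], dominated convergence gives
    the inner limit in [l], of density [r_n / (k m^n) nu(R)] with respect to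
    [Y_n], while the Yaglom limit gives the inner limit in [n], of density
    [m^(-l) H_l] with respect to [Qmin].  The latter tends to
    [phi(0) nu(R) Qmin] by dominated convergence.  For the former, replacing
    [nu(R)] by [H_l(nu) / q_l] changes integrals of functions bounded by [M] by
    at most [M] times the lost mass [1 - r_(n+l) / (k m^n q_l)], which tends to
    [1 - phi(0) m^l / q_l] as [n] grows and then to [0]; hence both iterated
    limits agree.

    Weak limits are unique because every finite point measure agrees on Borel
    sets with a finite sum of Dirac masses: the space is then hereditarily
    Lindelof, so its Borel sets are generated by the cozero sets of continuous
    functions. *)

(** * Survival probabilities *)

Section offspring.
Context {R : realType} (p : probability nat R).
Hypothesis hC1 : condC1 p.
Local Open Scope ring_scope.
Local Notation pmf := Defs.pmf.

Let m : R := fine (mean p).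

Lemma pmf_ge0 j : 0 <= pmf p j.
Proof. exact: fine_ge0. Qed.

Lemma pmf_EFin j : (pmf p j)%:E = p [set j].
Proof. by rewrite /pmf fineK// fin_num_measure. Qed.

Lemma cvg_series_nneseries (u : nat -> R) : (forall n, 0 <= u n) ->
  (\sum_(j <oo) (u j)%:E < +oo)%E ->
  series u n @[n --> \oo] --> fine (\sum_(j <oo) (u j)%:E)%E.
Proof.
move=> u0 uoo.
have fu : (\sum_(j <oo) (u j)%:E)%E \is a fin_num.
  by rewrite ge0_fin_numE// nneseries_ge0// => n _ _; rewrite lee_fin.
have cu : cvgn (fun n => \sum_(0 <= j < n) (u j)%:E)%E.
  by apply: is_cvg_nneseries => n _ _; rewrite lee_fin.
move/cvg_ex : cu => [l cl]; have ll := cvg_lim (@ereal_hausdorff R) cl.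
move: fu; rewrite ll => /fineK lE.
have /fine_cvg : (fun n =>
  \sum_(0 <= j < n) (u j)%:E)%E @ \oo --> (fine l)%:E by rewrite lE.
apply: cvg_trans; apply: near_eq_cvg; apply: nearW => n /=.
by rewrite sumEFin.
Qed.

Lemma sum_pmf : (\sum_(j <oo) (pmf p j)%:E = 1)%E.
Proof.
under eq_eseriesr do rewrite pmf_EFin.
rewrite -(probability_setT p) (_ : setT = \bigcup_i [set i]); last first.
  by apply/seteqP; split => // i _; exists i.
rewrite measure_semi_bigcup//.
by apply/trivIsetP => i j _ _ ij; rewrite -subset0 => k /= [-> /eqP];
  rewrite (negbTE ij).
Qed.

Lemma mean_EFin : mean p = m%:E.
Proof.
case: hC1 => /andP[m0 m1] _; rewrite fineK// ge0_fin_numE ?(ltW m0)//.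
by rewrite (lt_trans m1)// ltry.
Qed.

Lemma mean_gt0 : 0 < m.
Proof. by case: hC1 => /andP[+ _] _; rewrite mean_EFin lte_fin. Qed.

Lemma mean_lt1 : m < 1.
Proof. by case: hC1 => /andP[_ +] _; rewrite mean_EFin lte_fin. Qed.

(** With [x = 1 - s] this controls [1 - s ^+ j] to first and second order, which turns moments of
    the offspring law into bounds on [1 - genfun p s]. *)
Lemma bernoulli_le (x : R) n : 0 <= x <= 1 ->
  1 - n%:R * x <= (1 - x) ^+ n <= 1 - n%:R * x + (n%:R * x) ^+ 2.
Proof.
move=> /andP[x0 x1]; elim: n => [|n /andP[IH1 IH2]].
  by rewrite expr0 !mul0r; lra.
rewrite exprS -[n.+1]addn1 natrD; set k : R := n%:R in IH1 IH2 *.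
have k0 : 0 <= k by exact: ler0n.
set y := (1 - x) ^+ n in IH1 IH2 *.
have h : 0 <= 1 - x by lra.
have := ler_wpM2l h IH1; have := ler_wpM2l h IH2.
have k1 : 0 <= k * x ^+ 2 by rewrite mulr_ge0// sqr_ge0.
have k2 : 0 <= k * k * x ^+ 3 by rewrite !mulr_ge0// exprn_ge0.
have := sqr_ge0 x.
by move=> ? ? ?; apply/andP; split; nra.
Qed.

(** Comparison with [sum_pmf] makes the sum finite, so that the [limn] in the definition of [genfun]
    is the limit of a convergent series. *)
Lemma genfun_nneseries (s : R) : 0 <= s <= 1 ->
  (\sum_(j <oo) (pmf p j * s ^+ j)%:E = (genfun p s)%:E)%E.
Proof.
move=> /andP[s0 s1].
have u0 n : 0 <= pmf p n * s ^+ n by rewrite mulr_ge0 ?pmf_ge0 ?exprn_ge0.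
have uoo : (\sum_(j <oo) (pmf p j * s ^+ j)%:E < +oo)%E.
  apply: (@le_lt_trans _ _ 1%E); last exact: ltry.
  rewrite -sum_pmf; apply: lee_nneseries => [j _ _|j _]; rewrite lee_fin//.
  by rewrite ler_piMr ?pmf_ge0// exprn_ile1.
rewrite /genfun (cvg_lim _ (cvg_series_nneseries u0 uoo))// fineK//.
by rewrite ge0_fin_numE// nneseries_ge0// => n _ _; rewrite lee_fin.
Qed.

Lemma genfun_cvg (s : R) : 0 <= s <= 1 ->
  series (fun j => pmf p j * s ^+ j) n @[n --> \oo] --> genfun p s.
Proof.
move=> s01; have [s0 s1] := andP s01.
have -> : genfun p s =
  fine (\sum_(j <oo) (pmf p j * s ^+ j)%:E)%E by rewrite genfun_nneseries.
apply: cvg_series_nneseries; last by rewrite genfun_nneseries// ltry.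
by move=> n; rewrite mulr_ge0 ?pmf_ge0 ?exprn_ge0.
Qed.

Lemma pmf_cvg : series (pmf p) n @[n --> \oo] --> (1 : R).
Proof.
have -> : 1 = fine (\sum_(j <oo) (pmf p j)%:E)%E by rewrite sum_pmf.
by apply: cvg_series_nneseries; [exact: pmf_ge0|rewrite sum_pmf ltry].
Qed.

Lemma mean_cvg : series (fun j => j%:R * pmf p j) n @[n --> \oo] --> m.
Proof.
have -> : m = fine (\sum_(j <oo) (j%:R * pmf p j)%:E)%E by [].
apply: cvg_series_nneseries; first by move=> n; rewrite mulr_ge0 ?pmf_ge0.
by rewrite -/(mean p) mean_EFin ltry.
Qed.

Let M2 : R := fine (\sum_(j <oo) (j%:R ^+ 2 * pmf p j)%:E)%E.

Lemma moment2_cvg : series (fun j => j%:R ^+ 2 * pmf p j) n @[n --> \oo] --> M2.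
Proof.
apply: cvg_series_nneseries; last by case: hC1.
by move=> n; rewrite mulr_ge0 ?pmf_ge0 ?exprn_ge0.
Qed.

Lemma genfun_compl_cvg (s : R) : 0 <= s <= 1 ->
  series (fun j => pmf p j * (1 - s ^+ j)) n @[n --> \oo] --> 1 - genfun p s.
Proof.
move=> s01.
apply: cvg_trans (cvgB pmf_cvg (genfun_cvg s01)).
apply: near_eq_cvg; apply: nearW => n.
rewrite /series/= !fctE -sumrB; apply: eq_bigr => i _.
by rewrite mulrBr mulr1.
Qed.

Lemma series_scale (u : nat -> R) (c : R) n :
  series (fun j => u j * c) n = series u n * c.
Proof. by rewrite /series/= mulr_suml. Qed.

Lemma genfun_compl_le (s : R) : 0 <= s <= 1 -> 1 - genfun p s <= m * (1 - s).
Proof.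
move=> s01; have [s0 s1] := andP s01.
have h := cvgMr_tmp (b := 1 - s) mean_cvg.
apply: (ler_cvg_to (genfun_compl_cvg s01) (h _)).
apply: nearW => n; rewrite /= -series_scale; apply: ler_sum => j _.
rewrite mulrAC mulrC ler_wpM2r ?pmf_ge0//.
have /andP[+ _] : 1 - j%:R * (1 - s) <= (1 - (1 - s)) ^+ j <= 1 - j%:R *
  (1 - s) + (j%:R * (1 - s)) ^+ 2.
  by apply: bernoulli_le; lra.
by rewrite subKr; lra.
Qed.

(** Termwise second order bound. The finite second moment enters here; it will keep
    [survival n / m ^+ n] away from zero. *)
Lemma genfun_compl_ge (s : R) : 0 <= s <= 1 ->
  m * (1 - s) - M2 * (1 - s) ^+ 2 <= 1 - genfun p s.
Proof.
move=> s01; have [s0 s1] := andP s01.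
have h := cvgB (cvgMr_tmp (b := 1 - s) mean_cvg) (cvgMr_tmp (b := (1 - s) ^+
  2) moment2_cvg).
apply: (ler_cvg_to (h _ _ _)
  (genfun_compl_cvg s01)).
apply: nearW => n; rewrite /= !fctE -!series_scale -sumrB;
  apply: ler_sum => j _.
have /andP[_ +] : 1 - j%:R * (1 - s) <= (1 - (1 - s)) ^+ j <= 1 - j%:R *
  (1 - s) + (j%:R * (1 - s)) ^+ 2.
  by apply: bernoulli_le; lra.
rewrite subKr => {}h.
rewrite [leLHS](_ : _ = pmf p j * (j%:R * (1 - s) - (j%:R * (1 - s)) ^+ 2));
  last by ring.
by rewrite ler_wpM2l ?pmf_ge0//; lra.
Qed.

(** Since [m > 0], some [j >= 1] has positive probability, and its term [pmf p j * (1 - s ^+ j)]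
    alone is positive. *)
Lemma genfun_compl_gt0 (s : R) : 0 <= s < 1 -> 0 < 1 - genfun p s.
Proof.
move=> /andP[s0 s1].
have s01 : 0 <= s <= 1 by rewrite s0 ltW.
have [j pj] : exists j, j%:R * pmf p j != 0.
  apply/not_existsP => h; have := mean_gt0; rewrite /m /mean eseries0 ?ltxx//.
  by move=> j _ _; apply/eqP; rewrite eqe; apply/negPn/negP; exact: h.
have j0 : (0 < j)%N by case: j pj => //; rewrite mul0r eqxx.
have pj0 : 0 < pmf p j.
  by rewrite lt0r pmf_ge0 andbT; apply: contraNneq pj => ->; rewrite mulr0.
have v0 i : 0 <= pmf p i * (1 - s ^+ i).
  by rewrite mulr_ge0 ?pmf_ge0// subr_ge0 exprn_ile1// ltW.
apply: (@lt_le_trans _ _ (series (fun j => pmf p j * (1 - s ^+ j)) j.+1)).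
  rewrite /series/= big_nat_recr//= ltr_wpDl ?sumr_ge0// mulr_gt0// subr_gt0.
  by rewrite exprn_ilt1// -lt0n.
rewrite -(cvg_lim _ (genfun_compl_cvg s01))//; apply: nondecreasing_cvgn_le.
  by apply/nondecreasing_seqP => n; rewrite /series/= big_nat_recr//= lerDl.
by apply/cvg_ex; exists (1 - genfun p s); exact: genfun_compl_cvg.
Qed.

Definition survival n := 1 - iter n (genfun p) 0.

(* The probability that the offspring of [k] independent particles survives up
   to generation [n]. *)
Definition survival_from k n := 1 - iter n (genfun p) 0 ^+ k.

Lemma survival_gt0_le1 n : 0 < survival n <= 1.
Proof.
rewrite /survival; elim: n => [|n /andP[IH1 IH2]] /=; first by lra.
set s := iter n _ _ in IH1 IH2 *.
have s01 : 0 <= s < 1 by lra.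
rewrite genfun_compl_gt0//= gerBl.
have : (0 <= (genfun p s)%:E)%E.
  rewrite -genfun_nneseries; last by lra.
  apply: nneseries_ge0 => j _ _;
    rewrite lee_fin mulr_ge0 ?pmf_ge0// exprn_ge0//; lra.
by rewrite lee_fin.
Qed.

Lemma iter_genfun01 n : 0 <= iter n (genfun p) 0 < 1.
Proof. by have := survival_gt0_le1 n; rewrite /survival; lra. Qed.

Lemma survival_from_ge0 k n : 0 <= survival_from k n.
Proof.
have /andP[a0 a1] := iter_genfun01 n.
by rewrite subr_ge0 exprn_ile1// ltW.
Qed.

Lemma survival_from_le1 k n : survival_from k n <= 1.
Proof. by have /andP[a0 a1] := iter_genfun01 n; rewrite gerBl exprn_ge0. Qed.

Lemma survival_from_gt0 k n : (0 < k)%N -> 0 < survival_from k n.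
Proof.
move=> k0; have /andP[a0 a1] := iter_genfun01 n.
by rewrite subr_gt0 exprn_ilt1// -lt0n.
Qed.

(** Geometric sum; the monotonicity in [n] of [survival_from k n / survival n] is read off from
    it. *)
Lemma survival_from_sum k n :
  survival_from k n = survival n * \sum_(i < k) iter n (genfun p) 0 ^+ i.
Proof. by rewrite /survival_from /survival -opprB subrX1 -mulNr opprB. Qed.

Lemma survivalS_le n : survival n.+1 <= m * survival n.
Proof.
by apply: (@genfun_compl_le (iter n (genfun p) 0)); have := iter_genfun01 n;
  lra.
Qed.

Lemma survivalS_ge n : m * survival n - M2 * survival n ^+ 2 <= survival n.+1.
Proof.
by apply: (@genfun_compl_ge (iter n (genfun p) 0)); have := iter_genfun01 n;
  lra.
Qed.

Lemma survival_le n : survival n <= m ^+ n.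
Proof.
elim: n => [|n IH]; first by rewrite /survival/= subr0.
rewrite exprS (le_trans (survivalS_le n))// ler_wpM2l// ltW//; exact: mean_gt0.
Qed.

Lemma survival_cvg0 : survival n @[n --> \oo] --> (0 : R).
Proof.
have [m0 m1] := (mean_gt0, mean_lt1).
apply: (@squeeze_cvgr _ _ _ _ (cst 0) (fun n => m ^+ n)).
- by apply: nearW => n; rewrite survival_le andbT;
  have /andP[/ltW] := survival_gt0_le1 n.
- exact: cvg_cst.
- by apply: cvg_expr; rewrite ger0_norm// ltW.
Qed.

Let a n := survival n / m ^+ n.

Let a_gt0 n : 0 < a n.
Proof.
rewrite /a divr_gt0 ?exprn_gt0 ?mean_gt0//.
by have /andP[] := survival_gt0_le1 n.
Qed.

Lemma survival_ratioS n : a n.+1 <= a n.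
Proof.
have m0 := mean_gt0.
rewrite /a exprS invfM mulrA ler_pM2r ?invr_gt0 ?exprn_gt0//.
by rewrite ler_pdivrMr// mulrC survivalS_le.
Qed.

Lemma M2_ge0 : 0 <= M2.
Proof.
apply: fine_ge0; apply: nneseries_ge0 => j _ _.
by rewrite lee_fin mulr_ge0 ?pmf_ge0 ?exprn_ge0.
Qed.

(* From [a (n + 1) >= a n * (1 - M2 / m * m ^ n)] for
   [a n := survival n / m ^ n] one gets
   [a (N + i) >= a N * (1 - D * (m ^ N - m ^ (N + i)))] by summing a geometric
   series, where [N] is such that [D * m ^ N <= 1 / 2]. *)
Lemma survival_ratio_lb : exists2 c, 0 < c & forall n, c <= a n.
Proof.
have [m0 m1] := (mean_gt0, mean_lt1); have M0 := M2_ge0.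
pose D := M2 / (m * (1 - m)).
have D0 : 0 <= D by rewrite divr_ge0// mulr_ge0; lra.
have [N HN] : exists N, D * m ^+ N <= 2^-1.
  have : D * m ^+ n @[n --> \oo] --> (0 : R).
    rewrite -[X in _ --> X](mulr0 D); apply: cvgMl_tmp.
    by apply: cvg_expr; rewrite ger0_norm// ltW.
  move=> /cvgrPdist_le/(_ 2^-1);
    rewrite invr_gt0 ltr0n => /(_ isT)[N _ /(_ N (leqnn N))] /=.
  by rewrite sub0r normrN => /ler_normlW h; exists N.
exists (a N / 2); first by rewrite divr_gt0.
have nincr : {homo a : n k / (n <= k)%N >-> k <= n} by
  apply/nonincreasing_seqP => n; exact: survival_ratioS.
have step k : a N * (1 - D * (m ^+ N - m ^+ (N + k))) <= a (N + k).
  elim: k => [|k IH]; first by rewrite addn0 subrr mulr0 subr0 mulr1.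
  rewrite addnS; set l := (N + k)%N in IH *.
  have ml : 0 < m ^+ l by rewrite exprn_gt0.
  have [q0 q1] := andP (survival_gt0_le1 l).
  have h1 : a l * (1 - M2 / m * m ^+ l) <= a l.+1.
    have -> : a l * (1 - M2 / m * m ^+ l) =
      (m * survival l - M2 * survival l * m ^+ l) / m ^+ l.+1.
      by rewrite /a exprS; field; rewrite !lt0r_neq0.
    rewrite /a ler_pM2r ?invr_gt0 ?exprn_gt0//;
      apply: le_trans (survivalS_ge l).
    rewrite lerD2l lerN2 expr2 mulrA ler_wpM2l ?survival_le// mulr_ge0// ltW//.
  set x := M2 / m * m ^+ l.
  have x0 : 0 <= x by rewrite mulr_ge0 ?divr_ge0 ?(ltW ml)// ltW.
  have Dx : D * (m ^+ N - m ^+ l.+1) = D * (m ^+ N - m ^+ l) + x.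
    rewrite /x /D exprS; field; rewrite !lt0r_neq0//; lra.
  rewrite Dx; set y := D * (m ^+ N - m ^+ l) in IH *.
  have y0 : 0 <= y.
    by rewrite mulr_ge0// subr_ge0 /l exprD ler_piMr ?exprn_ge0 ?exprn_ile1
      ?(ltW m0) ?(ltW m1).
  have aN := a_gt0 N; have al := a_gt0 l.
  (* If [x > 1] the left-hand side is negative. Otherwise the induction hypothesis can be multiplied
     by [1 - x >= 0], and [1 - (y + x) <= (1 - y) * (1 - x)]. *)
  have [x1|x1] := leP x 1; last first.
    apply: le_trans (ltW (a_gt0 l.+1)); rewrite mulr_ge0_le0 ?(ltW aN)//; lra.
  apply: le_trans h1.
  apply: le_trans (_ : a N * (1 - y) * (1 - x) <= _).
    rewrite -mulrA ler_pM2l//; nra.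
  rewrite ler_wpM2r//; lra.
move=> n; apply: (@le_trans _ _ (a (N + n))); last by apply: nincr;
  rewrite leq_addl.
apply: le_trans (step n); rewrite ler_pM2l//.
have : 0 <= D * m ^+ (N + n) by rewrite mulr_ge0// exprn_ge0// ltW.
rewrite mulrBr; lra.
Qed.

Lemma phi0_cvg : survival n / m ^+ n @[n --> \oo] --> phi0 p.
Proof.
have [c c0 ca] := survival_ratio_lb.
apply: nonincreasing_is_cvgn.
  by apply/nonincreasing_seqP => n; exact: survival_ratioS.
by exists c => _ [n _ <-]; exact: ca.
Qed.

Lemma phi0_gt0 : 0 < phi0 p.
Proof.
have [c c0 ca] := survival_ratio_lb.
by apply: (lt_le_trans c0); apply: (ler_cvg_to (cvg_cst c) phi0_cvg);
  exact: nearW.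
Qed.

End offspring.

(** * The weak topology on point measures *)

Section point_measure_topology.
Context {R : realType}.
Local Notation S := (nzPointMeasure R).

Definition pm_count (nu : pointMeasure R) : nat :=
  Num.truncn (fine (pm_mass nu)).

Lemma pm_massE (nu : pointMeasure R) : pm_mass nu = (pm_count nu)%:R%:E.
Proof.
have [k hk] := pm_natural nu measurableT.
by rewrite /pm_count /pm_mass hk /= natrK.
Qed.

Lemma pm_count_pointSum (s : seq R) : pm_count (pointSum s) = size s.
Proof.
rewrite /pm_count /pm_mass /= diracsE; under eq_bigr do rewrite diracT.
by rewrite sumEFin big_const_seq count_predT iter_addr_0 /= natrK.
Qed.

Lemma pm_count_gt0 (nu : S) : (0 < pm_count nu)%N.
Proof.
rewrite lt0n; apply/eqP => c0; have := set_mem (valP nu); rewrite /=.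
by rewrite -[X in X != 0]/(pm_mass (nzpm_val nu)) pm_massE c0 eqxx.
Qed.

Lemma pm_int1 (nu : pointMeasure R) : pm_int nu (cst 1%R) = (pm_count nu)%:R%R.
Proof.
by rewrite /pm_int /Rintegral (@integral_cst _ _ _ nu setT measurableT 1%E)
  mul1e -[nu setT]/(pm_mass nu) pm_massE.
Qed.

(** Integration against [f] is the coordinate of index [f] in the product topology that [pairing]
    pulls back. *)
Lemma continuous_pm_int (f : R -> R) : continuous f -> bounded_fun f ->
  continuous (fun nu : pointMeasure R => pm_int nu f).
Proof.
move=> cf bf.
pose g : @boundedContinuous R := exist _ f (conj cf bf).
move=> nu; apply: (@continuous_comp _ _ _ (@pairing R)
  (fun h : {ptws @boundedContinuous R -> R} => h g)).
  exact: initial_continuous.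
have /cvg_sup/(_ g) H : nbhs (pairing nu) --> pairing nu by exact: cvg_id.
move=> U; rewrite /= nbhsE => -[W [oW Wf] WU]; apply: H.
exists ((fun h : @boundedContinuous R -> R => h g) @^-1` W); split => //;
  first by exists W.
by move=> h /WU.
Qed.

Lemma continuous_nzpm_val : continuous (@nzpm_val R).
Proof. exact: initial_continuous. Qed.

Lemma continuous_nz_pm_int (f : R -> R) : continuous f -> bounded_fun f ->
  continuous (fun nu : S => pm_int nu f).
Proof.
move=> cf bf nu; apply: (@continuous_comp _ _ _ (@nzpm_val R) (fun h =>
  pm_int h f)).
  exact: continuous_nzpm_val.
exact: continuous_pm_int.
Qed.

Lemma continuous_pm_count : continuous (fun nu : S => (pm_count nu)%:R : R).
Proof.
have -> : (fun nu : S => (pm_count nu)%:R%R) = (fun nu : S =>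
  pm_int nu (cst 1%R)).
  by apply/funext => nu; rewrite pm_int1.
apply: continuous_nz_pm_int; first exact: cst_continuous.
by exists 1%R; split => // x /= x1 y _; rewrite normr1 ltW.
Qed.

Lemma nz_open_measurable (U : set S) : open U -> measurable U.
Proof. by move=> oU; apply: sub_sigma_algebra. Qed.

Lemma continuous_nz_measurable (F : S -> R) : continuous F ->
  measurable_fun [set: S] F.
Proof.
move=> /continuousP cF.
apply: (measurability _ (@RGenOInfty.measurableE R)) => _ [_ [x ->] <-].
rewrite setTI; apply: nz_open_measurable; apply: cF; exact: rray_open.
Qed.

Lemma measurable_pm_count_eq j : measurable [set nu : S | pm_count nu = j].
Proof.
have /= := continuous_nz_measurable continuous_pm_count measurableT
  (measurable_set1 (j%:R : R)%R).
rewrite setTI; congr measurable; apply/seteqP; split => nu /=.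
  by move/eqP; rewrite eqr_nat => /eqP.
by move=> ->.
Qed.

(** The mass takes countably many values, so preimages are countable unions of its level sets,
    whatever [g] is. *)
Lemma measurable_fun_pm_count d (T : measurableType d) (g : nat -> T) :
  measurable_fun [set: S] (fun nu : S => g (pm_count nu)).
Proof.
move=> _ B mB; rewrite setTI.
rewrite (_ : _ @^-1` _ =
  \bigcup_(j in g @^-1` B) [set nu : S | pm_count nu = j]).
  by apply: bigcup_measurable => j _; exact: measurable_pm_count_eq.
by apply/seteqP; split => [nu Bnu|nu [j Bj /= cj]];
  [exists (pm_count nu)|rewrite /= cj].
Qed.

(** * Finite point measures as sums of Dirac masses *)

Lemma pm_ge1 (nu : pointMeasure R) A : measurable A -> nu A != 0 -> 1 <= nu A.
Proof.
move=> mA; have [k ->] := pm_natural nu mA.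
by case: k => [|k _]; rewrite ?eqxx// lee_fin ler1n.
Qed.

Lemma pm_fin_num (nu : pointMeasure R) A : measurable A -> nu A \is a fin_num.
Proof. by move=> mA; have [k ->] := pm_natural nu mA. Qed.

(* The atom is the supremum of the [t] with [nu `]-oo, t] = 0]. *)
Lemma pm_atom (nu : pointMeasure R) : nu setT != 0 ->
  exists x : R, 1 <= nu [set x].
Proof.
move=> nu0.
pose I (t : R) : set R := `]-oo, t]%classic.
have mI t : measurable (I t) by exact: measurable_itv.
have leI (s t : R) : (s <= t)%R -> nu (I s) <= nu (I t).
  move=> st; apply: le_measure; rewrite ?inE//.
  by apply: subset_itvl; rewrite bnd_simp.
pose Z := [set t : R | nu (I t) = 0].
(* The masses of []-oo, -n]] decrease to zero and are natural numbers, so one of them vanishes. *)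
have [a Za] : Z !=set0.
  have : nu \o (fun n => I (- n%:R)%R) @ \oo --> nu (\bigcap_n I (- n%:R)%R).
    apply: nonincreasing_cvg_mu => //.
    - by rewrite ltey_eq pm_fin_num.
    - exact: bigcapT_measurable.
    - move=> m n mn; apply/subsetPset/subset_itvl.
      by rewrite bnd_simp lerN2 ler_nat.
  rewrite (_ : \bigcap_n _ = set0); last first.
    rewrite -subset0 => y /= h.
    have := h (Num.bound `|y|%R) Logic.I; rewrite /I /= in_itv/= => yb.
    have := archi_boundP (normr_ge0 y); rewrite ltNge => /negP; apply.
    by rewrite ler_normr lerNr yb orbT.
  rewrite measure0 => /fine_cvgP[_ /cvgrPdist_lt/(_ 1%R ltr01)[n _ /(_ n
    (leqnn n))]] /=.
  rewrite sub0r normrN => h; exists (- n%:R)%R; rewrite /Z /=.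
  apply/eqP/negPn/negP => /pm_ge1 => /(_ (mI _)).
  rewrite -(fineK (pm_fin_num nu (mI _))) lee_fin => h1.
  by move: h; rewrite ger0_norm ?fine_ge0// ltNge h1.
(* The half-lines increase to the whole line, which is charged; hence some half-line is charged, and
   its endpoint bounds [Z]. *)
have [b Zb] : exists b, forall t, Z t -> (t <= b)%R.
  have : nu \o (fun n => I n%:R%R) @ \oo --> nu (\bigcup_n I n%:R%R).
    apply: nondecreasing_cvg_mu => //.
    - exact: bigcupT_measurable.
    - move=> m n mn; apply/subsetPset/subset_itvl.
      by rewrite bnd_simp ler_nat.
  rewrite (_ : \bigcup_n _ = setT); last first.
    rewrite -subTset => y _; exists (Num.bound `|y|%R) => //;
      rewrite /I /= in_itv/=.
    by rewrite (le_trans (ler_norm y))// ltW// archi_boundP.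
  move=> h; have [n hn] : exists n : nat, nu (I n%:R%R) != 0.
    apply/not_existsP => h0; move: nu0; rewrite -(cvg_lim _ h)//.
    rewrite (_ : nu \o _ = cst 0) ?lim_cst ?eqxx//.
    by apply/funext => n /=; apply/eqP/negPn/negP/h0.
  exists n%:R%R => t Zt; rewrite leNgt; apply/negP => /ltW/leI; rewrite Zt.
  by rewrite leNgt lt0e hn measure_ge0.
have hZ : has_sup Z by split; [exists a|exists b].
pose x := sup Z; exists x.
have lt0 : nu `]-oo, x[%classic = 0.
  rewrite (_ : `]-oo, x[%classic = \bigcup_n I (x - n.+1%:R^-1)%R); last first.
    apply/seteqP; split => [y|y [n _]]; rewrite /I /= !in_itv/=.
      by move=> /ltr_add_invr[k kx]; exists k => //;
        rewrite /= in_itv/= lerBrDr ltW.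
    by move=> /le_lt_trans; apply; rewrite gtrBl invr_gt0.
  apply/eqP; rewrite eq_le measure_ge0 andbT.
  have : nu (\bigcup_n I (x - n.+1%:R^-1)%R) <= \sum_(n <oo) nu (I (x -
    n.+1%:R^-1)%R).
    apply: measure_sigma_subadditive => //; exact: bigcupT_measurable.
  rewrite eseries0// => n _ _.
  have [e Ze xe] : exists2 e, Z e & (x - n.+1%:R^-1 < e)%R.
    by apply: sup_adherent => //; rewrite invr_gt0.
  by apply/eqP; rewrite eq_le measure_ge0 andbT -Ze leI// ltW.
(* Every half-line ending to the right of [x] is charged, hence has mass at least 1; continuity from
   above passes this on to [I x]. *)
have ge1 : 1 <= nu (I x).
  have : nu \o (fun n => I (x +
    n.+1%:R^-1)%R) @ \oo --> nu (\bigcap_n I (x + n.+1%:R^-1)%R).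
    apply: nonincreasing_cvg_mu => //.
    - by rewrite ltey_eq pm_fin_num.
    - exact: bigcapT_measurable.
    - move=> m n mn; apply/subsetPset/subset_itvl.
      by rewrite bnd_simp lerD2l lef_pV2 ?posrE// ler_nat ltnS.
  rewrite (_ : \bigcap_n _ = I x); last first.
    apply/seteqP; split => [y h|y yx n _]; rewrite /I /= in_itv/=.
      rewrite leNgt; apply/negP => /ltr_add_invr[k]; rewrite ltNge => /negP;
        apply.
      by have := h k Logic.I; rewrite /I /= in_itv.
    by move: yx; rewrite /I /= in_itv/= => /le_trans; apply; rewrite lerDl.
  move=> h; rewrite -(cvg_lim _ h)//; apply: lime_ge; first by apply/cvg_ex;
    exists (nu (I x)).
  apply: nearW => n /=; apply: pm_ge1 => //; apply/eqP => Zx.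
  have := sup_upper_bound hZ Zx; rewrite -/x gerDl leNgt; apply/negP/negPn.
  by rewrite invr_gt0.
have : nu (I x) = nu `]-oo, x[%classic + nu [set x].
  rewrite -measureU//; last by rewrite -subset0 => y /= [+ yx];
    rewrite yx in_itv/= ltxx.
  by congr (nu _); rewrite /I -(@setUitv1 _ R -oo%O x true).
by rewrite lt0 add0e => <-.
Qed.

(** Strong induction on the total mass: deleting all the mass at an atom leaves a point measure of
    strictly smaller mass, and the deleted part is a repetition of that atom. *)
Lemma pm_decomp (nu : pointMeasure R) :
  exists s : seq R, forall A, measurable A -> nu A = pointSum s A.
Proof.
have [n] := ubnP (pm_count nu); elim: n nu => // n IH nu; rewrite ltnS => nun.
have [nu0|nu0] := eqVneq (nu setT) 0.
  exists [::] => A mA; rewrite /= diracsE big_nil; apply/eqP.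
  by rewrite eq_le measure_ge0 andbT -nu0 le_measure ?inE.
have [x x1] := pm_atom nu0.
have mx : measurable (~` [set x]) by exact: measurableC.
have nat' A : measurable A -> exists k : nat, mrestr nu mx A = k%:R%:E.
  by move=> mA; apply: pm_natural; exact: measurableI.
pose nu' := PointMeasure nat'.
have nuE A : measurable A -> nu A = nu (A `&` [set x]) + nu' A.
  move=> mA; rewrite /nu'/= /mrestr -measureU//; last 3 first.
  - exact: measurableI.
  - exact: measurableI.
  - by rewrite setIACA setICr setI0.
  by rewrite -setIUr setUCr setIT.
have [|s sE] := IH nu'.
  have := nuE _ measurableT; rewrite setTI.
  rewrite -[nu setT]/(pm_mass nu) -[nu' setT]/(pm_mass nu') !pm_massE.
  have [k kE] := pm_natural nu (measurable_set1 x).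
  move: x1; rewrite kE lee_fin ler1n -EFinD -natrD => k0 [/eqP];
    rewrite eqr_nat => /eqP.
  lia.
have [k kE] := pm_natural nu (measurable_set1 x).
exists (nseq k x ++ s) => A mA; rewrite nuE// sE//= !diracsE big_cat/=;
  congr (_ + _).
rewrite big_nseq; have [xA|xA] := boolP (x \in A).
  rewrite (_ : A `&` [set x] = [set x]); last first.
    by apply/seteqP; split => [y []//|y /= ->]; split => //; exact: set_mem.
  have -> : \d_x A = 1 :> \bar R by rewrite diracE xA.
  by rewrite kE; elim: (k) => //= j <-; rewrite -EFinD -natr1 addrC.
rewrite (_ : A `&` [set x] = set0); last first.
  by rewrite -subset0 => y /= [+ yx]; rewrite yx => /mem_set;
    rewrite (negbTE xA).
have -> : \d_x A = 0 :> \bar R by rewrite diracE (negbTE xA).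
by rewrite measure0; elim: (k) => //= j <-; rewrite add0e.
Qed.

(** The weak topology does not separate measures that agree on Borel sets, so a configuration can be
    replaced by a Dirac sum when testing membership in an open set. *)
Lemma eq_pm_pairing (nu nu' : pointMeasure R) :
  (forall A, measurable A -> nu A = nu' A) -> pairing nu = pairing nu'.
Proof.
move=> h; apply/funext => f; congr fine.
by apply: eq_measure_integral => A mA _; exact: h.
Qed.

(** * Cozero sets and the Borel sigma-algebra *)

Lemma continuous_one_sub (T : topologicalType) (f : T -> R) :
  continuous f -> continuous (fun x => 1 - f x)%R.
Proof. by move=> cf x; apply: cvgB; [exact: cvg_cst|exact: cf]. Qed.

Lemma continuous_scale (T : topologicalType) (f : T -> R) (c : R) :
  continuous f -> continuous (fun x => c * f x)%R.
Proof. by move=> cf x; apply: cvgMl_tmp; exact: cf. Qed.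

(* The topology is pulled back from the product uniformity, hence completely
   regular. *)
Lemma pm_urysohn (U : set (pointMeasure R)) nu : open U -> U nu ->
  exists F : {ptws @boundedContinuous R -> R} -> R,
    [/\ continuous F, forall h, (0 <= F h <= 1)%R, (0 < F (pairing nu))%R &
        forall nu', (0 < F (pairing nu'))%R -> U nu'].
Proof.
move=> [W oW <-] Wnu.
have : uniform_separator
  [set (pairing nu : {ptws @boundedContinuous R -> R})] (~` W).
  have := @uniform_completely_regular R
    (prod_topology (fun _ : @boundedContinuous R => R)).
  by apply; [exact: open_closedC|exact].
move=> /(@uniform_separatorP _ R)[f [cf f01 f0 f1]].
exists (fun h => 1 - f h)%R; split.
- exact: continuous_one_sub.
- move=> h; have : range f (f h) by exists h.
  by move/f01; rewrite /= in_itv/= => /andP[? ?]; apply/andP; split; lra.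
- have : (f @` [set pairing nu]) (f (pairing nu)) by exists (pairing nu).
  by move/f0 => /= ->; rewrite subr0.
- move=> nu'; apply: contraPP => nW.
  have : (f @` (~` W)) (f (pairing nu')) by exists (pairing nu').
  by move/f1 => /= ->; rewrite subrr ltxx.
Qed.

(** Provides a countable base: a radius [1 / (m + 1)] below [e / 2] and a rational centre within
    that radius of [s]. *)
Lemma rat_seq_ball (s : seq R) e : (0 < e)%R -> exists q : seq rat * nat,
  seq_ball (map ratr q.1) q.2.+1%:R^-1 s /\
  seq_ball (map ratr q.1) q.2.+1%:R^-1 `<=` seq_ball s e.
Proof.
move=> e0.
have [m me] : exists m : nat, (m.+1%:R^-1 < e / 2)%R.
  have e20 : (0 < e / 2)%R by rewrite divr_gt0.
  have [m _ /(_ m (leqnn m))] := near_infty_natSinv_lt (PosNum e20).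
  by exists m.
have ex i : exists q : rat, (`|ratr q - nth 0 s i| < m.+1%:R^-1)%R.
  have /rat_in_itvoo[q] : (nth 0 s i - m.+1%:R^-1 < nth 0 s i + m.+1%:R^-1)%R.
    by rewrite ltrD2l gt0_cp// invr_gt0.
  by rewrite in_itv/= => qs; exists q; rewrite distrC ltr_distlC.
have [q qs] := choice ex.
exists (mkseq q (size s), m) => /=; split.
  split; first by rewrite !size_map size_iota.
  move=> i; rewrite !size_map size_iota => iL.
  by rewrite (nth_map 0%R) ?size_mkseq// nth_mkseq.
move=> t [ts st]; split.
  by rewrite ts !size_map size_iota.
move=> i iL; have := st i; rewrite size_map size_mkseq => /(_ iL).
rewrite (nth_map 0%R) ?size_mkseq// nth_mkseq// => H1.
rewrite (splitr e) (le_lt_trans (ler_distD (ratr (q i)) _ _))// ltrD//.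
  by rewrite distrC (lt_trans (qs i)).
exact: lt_trans H1 me.
Qed.

Definition cozero : set (set S) := [set V | exists F : S -> R,
  [/\ continuous F, forall nu, (0 <= F nu <= 1)%R &
    V = [set nu | (0 < F nu)%R]]].

(* Hereditary Lindelof property: up to indistinguishability, the space is the
   continuous image of the second countable space of finite sequences. *)
Lemma open_bigcup_cozero (U : set S) : open U ->
  exists V : (set S)^nat, (forall i, cozero (V i)) /\ U = \bigcup_i V i.
Proof.
move=> [U' oU' UU'].
(* [V] must contain all configurations represented by some sequence of the rational ball [q], since
   the representing sequence is not unique. *)
pose near_q (q : seq rat * nat) (V : set S) := forall t (nu : S),
  seq_ball (map ratr q.1) q.2.+1%:R^-1 t ->
  (forall A, measurable A -> nu A = pointSum t A) -> V nu.
have cozero0 : cozero set0.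
  exists (fun=> 0%R); split; first exact: cst_continuous.
  - by move=> nu; rewrite lexx ler01.
  - by apply/seteqP; split => // nu /=; rewrite ltxx.
(* For each of the countably many rational balls, one suitable cozero set inside [U] is chosen if
   there is any, and the empty set otherwise. *)
have exV (i : nat) : exists V, [/\ cozero V, V `<=` U &
    forall q, unpickle i = Some q ->
      (exists2 V', cozero V' & V' `<=` U /\ near_q q V') -> near_q q V].
  case: (unpickle i) => [q|]; last by exists set0; split.
  have [[V cV [VU nV]]|nV] := pselect (exists2 V',
    cozero V' & V' `<=` U /\ near_q q V').
    by exists V; split => // _ [<-].
  by exists set0; split => // _ [<-].
have [V HV] := choice exV; exists V; split; first by move=> i; have [] := HV i.
apply/seteqP; split => [nu Unu|nu [i _]]; last by have [_ + _] := HV i; exact.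
have U'nu : U' (nzpm_val nu) by rewrite -UU' in Unu.
have [F [cF F01 Fnu FU]] := pm_urysohn oU' U'nu.
have [s sE] := pm_decomp nu.
have oF : open [set h | (0 < F h)%R].
  rewrite (_ : [set h | _] = F @^-1` [set` `]0%R, +oo[ ]); last first.
    by apply/seteqP; split => h /=; rewrite in_itv/= andbT.
  by move/continuousP: cF; apply; exact: rray_open.
pose W : set (pointMeasure R) := @pairing R @^-1` [set h | (0 < F h)%R].
have oW : open W by exists [set h | (0 < F h)%R].
have Ws : W (pointSum s) by rewrite /W /= -(eq_pm_pairing sE).
(* A ball around [s] is mapped into [W]; a rational ball [q] inside it shows that a suitable cozero
   set was available at the index [pickle q]. *)
have [e /= e0 sW] := @pointSum_cvg R s W (open_nbhs_nbhs (conj oW Ws)).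
have [q [qs sq]] := rat_seq_ball s e0.
exists (pickle q) => //; have [_ _ /(_ q (pickleK q))] := HV (pickle q).
apply; last 2 first.
- exact: qs.
- exact: sE.
exists [set nu' : S | W (nzpm_val nu')].
  exists (fun nu' : S => F (pairing (nzpm_val nu'))); split => //.
  move=> nu'; apply: (@continuous_comp _ _ _ (@nzpm_val R) (fun h =>
    F (pairing h))).
    exact: continuous_nzpm_val.
  apply: (@continuous_comp _ _ _ (@pairing R) F); last exact: cF.
  exact: initial_continuous.
split; first by move=> nu' /= /FU; rewrite -UU'.
move=> t nu' /sq/sW Wt tE; move: Wt.
by rewrite /W/= (eq_pm_pairing tE).
Qed.

Lemma cozeroI : setI_closed cozero.
Proof.
move=> _ _ [F [cF F01 ->]] [G [cG G01 ->]].
exists (fun nu => Num.min (F nu) (G nu)); split.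
- by move=> nu; apply: continuous_min; [exact: cF|exact: cG].
- move=> nu; have /andP[? ?] := F01 nu; have /andP[? ?] := G01 nu.
  by rewrite le_min ge_min; apply/andP; split; apply/andP || apply/orP;
    [split|left].
- by apply/seteqP; split => nu /=; rewrite lt_min => /andP.
Qed.

Lemma bounded_fun01 (T : Type) (F : T -> R) :
  (forall x, 0 <= F x <= 1)%R -> bounded_fun F.
Proof.
move=> F01; exists 1%R; split => // M M1 x _ /=.
by have /andP[F0 F1] := F01 x; rewrite ger0_norm// (le_trans F1)// ltW.
Qed.

Lemma cozero_measurable V : cozero V -> measurable V.
Proof.
move=> [F [cF F01 ->]];
  have /= := continuous_nz_measurable cF measurableT (measurable_itv `]0%R,
  +oo[).
by rewrite setTI; congr measurable; apply/seteqP; split => nu /=;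
  rewrite in_itv/= andbT.
Qed.

Lemma bounded_integrable d (T : measurableType d) (Q : probability T R)
    (F : T -> R) :
  measurable_fun [set: T] F -> bounded_fun F ->
  Q.-integrable [set: T] (EFin \o F).
Proof.
move=> mF bF; apply: measurable_bounded_integrable => //.
by rewrite (le_lt_trans (probability_le1 _ _))// ltry.
Qed.

(** The indicator of a cozero set is an increasing limit of bounded continuous functions, so both
    measures agree there. Cozero sets are closed under intersection and, by [open_bigcup_cozero],
    generate the Borel sets. *)
Lemma weak_determined (Q1 Q2 : probability S R) :
  (forall F : S -> R, continuous F -> bounded_fun F ->
    (\int[Q1]_nu F nu = \int[Q2]_nu F nu)%R) -> Q1 ≡μ Q2.
Proof.
move=> H.
have eq_cozero V : cozero V -> Q1 V = Q2 V.
  move=> cV; have mV := cozero_measurable cV; move: cV => [F [cF F01 VE]].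
  pose G n (nu : S) : R := Num.min 1%R (n%:R * F nu)%R.
  have G01 n nu : (0 <= G n nu <= 1)%R.
    by rewrite /G ge_min lexx/= le_min ler01 mulr_ge0//; have /andP[] := F01 nu.
  have cG n : continuous (G n).
    move=> nu; apply: (@continuous_min _ _ (fun=> 1%R) (fun nu =>
      n%:R * F nu)%R nu).
      exact: cst_continuous.
    exact: continuous_scale cF nu.
  have cvg (Q : probability S R) : (\int[Q]_nu (G n nu)%:E) @[n --> \oo] --> Q
    V.
    rewrite -[Q V]mul1e -integral_cst// integral_mkcond.
    rewrite (_ : (cst 1 \_ V) = (fun nu => limn (fun n => (G n nu)%:E)));
      last first.
      apply/funext => nu; rewrite patchE; apply/esym/cvg_lim => //.
      case: ifPn => [/set_mem|/negP nV].
        rewrite VE /= => Fnu; apply: cvg_near_cst.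
        exists (Num.bound (F nu)^-1) => // n /= Fn.
        rewrite /G min_l// -ler_pdivrMr// div1r (@le_trans _ _ (Num.bound (F
          nu)^-1)%:R)%R ?ler_nat//.
        by rewrite ltW// archi_boundP// invr_ge0 ltW.
      have F0 : F nu = 0%R.
        apply/eqP; rewrite eq_le; have /andP[-> _] := F01 nu;
          rewrite andbT leNgt.
        by apply/negP => h; apply: nV; apply/mem_set; rewrite VE.
      apply: cvg_near_cst; apply: nearW => n.
      by rewrite /G F0 mulr0 min_r.
    apply: cvg_monotone_convergence => //.
    - by move=> n; apply/measurable_EFinP; exact: continuous_nz_measurable.
    - by move=> n nu _; rewrite lee_fin; have /andP[] := G01 n nu.
    - move=> nu _ a b ab; rewrite lee_fin /G le_min2// ler_wpM2r ?ler_nat//.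
      by have /andP[] := F01 nu.
  rewrite -(cvg_lim _ (cvg Q1))// -(cvg_lim _ (cvg Q2))//.
  congr (limn _); apply/funext => n.
  have GE (Q : probability S R) : \int[Q]_nu (G n nu)%:E =
    (\int[Q]_nu G n nu)%R%:E.
    rewrite /Rintegral fineK//; apply: integrable_fin_num => //.
    apply: bounded_integrable; first exact: continuous_nz_measurable.
    by apply: bounded_fun01; exact: G01.
  by rewrite !GE H//; apply: bounded_fun01; exact: G01.
have cozeroT : cozero setT.
  exists (fun=> 1%R); split; first exact: cst_continuous.
  - by move=> nu; rewrite lexx ler01.
  - by apply/seteqP; split => nu //= _; exact: ltr01.
have sub : borel `<=` <<s cozero >>.
  apply: smallest_sub; first exact: smallest_sigma_algebra.
  move=> U /open_bigcup_cozero[V [cV ->]].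
  by apply: sigma_algebra_bigcup => i; apply: sub_sigma_algebra.
move=> A mA; apply: (@g_sigma_algebra_measure_unique _ _ _ cozero _ (fun=>
  setT)) => //.
- exact: cozero_measurable.
- exact: bigcup_const.
- exact: cozeroI.
- by move=> _; rewrite (le_lt_trans (probability_le1 _ _))// ltry.
- exact: sub.
Qed.

(** Makes [nu |-> nu(h)] measurable for Borel [h], as the Laplace functional requires. Open rays are
    handled by continuous approximation, and Dynkin's theorem extends the claim to all Borel
    sets. *)
Lemma measurable_pm_eval (A : set R) : measurable A ->
  measurable_fun [set: S] (fun nu : S => nu A).
Proof.
(* Ramps that vanish up to [x], rise with slope [n] and are capped at 1; they increase to the
   indicator of []x, +oo[]. *)
pose f (x : R) (n : nat) (y : R) : R := Num.max 0%R (Num.min 1%R (n%:R *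
  (y - x)))%R.
have f01 x n y : (0 <= f x n y <= 1)%R.
  by rewrite /f ge_max ler01 ge_min lexx le_max lexx.
have cf x n : continuous (f x n).
  move=> y; apply: (@continuous_max _ _ (fun=> 0%R) (fun y =>
    Num.min 1%R (n%:R * (y - x)))%R y).
    exact: cst_continuous.
  apply: (@continuous_min _ _ (fun=> 1%R) (fun y => n%:R * (y - x))%R y).
    exact: cvg_cst.
  by apply: cvgMl_tmp; apply: cvgB; [exact: cvg_id|exact: cvg_cst].
have total : measurable_fun [set: S] (fun nu : S => nu [set: R]).
  rewrite (_ : (fun _ => _) = EFin \o (fun nu : S => (pm_count nu)%:R%R)).
    by apply/measurable_EFinP; apply: continuous_nz_measurable;
      exact: continuous_pm_count.
  by apply/funext => nu /=; rewrite -pm_massE.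
have ray x : measurable_fun [set: S] (fun nu : S => nu `]x, +oo[%classic).
  apply: (@emeasurable_fun_cvg _ _ _ _ (fun n (nu : S) =>
    \int[nu]_y (f x n y)%:E)).
    move=> n; rewrite (_ : (fun _ => _) = EFin \o (fun nu : S =>
      pm_int nu (f x n))); last first.
      apply/funext => nu /=; rewrite /pm_int /Rintegral fineK//.
      apply: integrable_fin_num => //;
        apply: measurable_bounded_integrable => //.
      - by rewrite ltey_eq pm_fin_num.
      - exact: continuous_measurable_fun.
      - by apply: bounded_fun01; exact: f01.
    apply/measurable_EFinP; apply: continuous_nz_measurable;
      apply: continuous_nz_pm_int => //.
    by apply: bounded_fun01; exact: f01.
  move=> nu _; rewrite -[X in _ --> X]mul1e -integral_cst// integral_mkcond.
  rewrite (_ : (cst 1 \_ _) = (fun y => limn (fun n => (f x n y)%:E)));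
    last first.
    apply/funext => y; rewrite patchE; apply/esym/cvg_lim => //.
    case: ifPn => [/set_mem|/negP nV].
      rewrite /= in_itv/= andbT -subr_gt0 => xy; apply: cvg_near_cst.
      exists (Num.bound (y - x)^-1) => // n /= Fn.
      rewrite /f min_l ?max_r// -ler_pdivrMr// div1r (@le_trans _ _ (Num.bound
        (y - x)^-1)%:R)%R ?ler_nat//.
      by rewrite ltW// archi_boundP// invr_ge0 ltW.
    have F0 : (y - x <= 0)%R.
      rewrite subr_le0 leNgt; apply/negP => h; apply: nV; apply/mem_set.
      by rewrite /= in_itv/= h.
    apply: cvg_near_cst; apply: nearW => n.
    by rewrite /f max_l// ge_min (mulr_ge0_le0 _ F0) ?orbT.
  apply: cvg_monotone_convergence => //.
  - by move=> n; apply/measurable_EFinP; exact: continuous_measurable_fun.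
  - by move=> n y _; rewrite lee_fin; have /andP[] := f01 x n y.
  - move=> y _ a b ab; rewrite lee_fin /f.
    have [xy|xy] := leP 0%R (y - x)%R.
      by rewrite le_max2// le_min2// ler_wpM2r ?ler_nat//.
    rewrite max_l; last by rewrite ge_min mulr_ge0_le0 ?orbT// ltW.
    by rewrite le_max lexx.
rewrite [X in X A -> _](RGenOInfty.measurableE R) => mA.
apply: (@dynkin_induction _ R _ (fun A =>
  measurable_fun [set: S] (fun nu : S => nu A))
  (RGenOInfty.measurableE R) _ _ _ _ _ _ mA).
- move=> _ _ [x ->] [y ->]; exists (Num.max x y).
  apply/seteqP; split => z /=; rewrite !in_itv/= !andbT gt_max => /andP//.
- exact: total.
- by move=> _ [x ->].
- move=> B mB mnuB.
  rewrite (_ : (fun _ => _) = (fun nu : S => nu setT - nu B)); last first.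
    by apply/funext => nu; rewrite -setTD measureD ?setTI ?ltey_eq ?pm_fin_num.
  exact: emeasurable_funB.
- move=> F mF tF mnuF.
  rewrite (_ : (fun _ => _) = (fun nu : S => \sum_(i <oo) nu (F i)));
    last first.
    by apply/funext => nu; rewrite measure_semi_bigcup//;
      exact: bigcup_measurable.
  by apply: ge0_emeasurable_sum => //= n _ nu _; exact: measure_ge0.
Qed.

Lemma measurable_pm_integral (h : R -> \bar R) : measurable_fun [set: R] h ->
  (forall x, 0 <= h x) -> measurable_fun [set: S] (fun nu : S =>
    \int[nu]_y h y).
Proof.
move=> mh h0; apply: (@measurable_fun_integral_kernel _ _ S R R (fun nu : S =>
  pm_measure nu)) => //.
exact: measurable_pm_eval.
Qed.

End point_measure_topology.

(** * The branching property *)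

Lemma population_generation d (Omega : measurableType d)
    (nu : label -> {mfun Omega >-> nat}) k n w v :
  v \in population nu k n w -> generation v = n.
Proof.
elim: n v => [|n IH] v /=; first by case/mapP => i _ ->.
by case/allpairsPdep => u [j] [/IH <- _ ->].
Qed.

Lemma population_uniq d (Omega : measurableType d)
    (nu : label -> {mfun Omega >-> nat}) k n w :
  uniq (population nu k n w).
Proof.
elim: n => [|n IH] /=.
  by rewrite map_inj_uniq ?iota_uniq// => i j [].
apply: allpairs_uniq_dep => // [v _|]; first exact: iota_uniq.
by move=> [[i u] j] [[i' u'] j'] _ _ [-> -> ->].
Qed.

Lemma eq_population d d' (Omega : measurableType d) (Omega' : measurableType d')
    (nu : label -> {mfun Omega >-> nat}) (nu' : label -> {mfun Omega' >-> nat})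
    k n w w' :
  (forall v, (generation v < n)%N -> nu v w = nu' v w') ->
  population nu k n w = population nu' k n w'.
Proof.
elim: n => [//|n IH] h /=; rewrite -IH; last by move=> v vn; rewrite h// ltnW.
congr flatten; apply/eq_in_map => v /population_generation vn.
by rewrite h// vn.
Qed.

(** * Measurability with respect to the history *)

Section history.
Context d (Omega : measurableType d) (R : realType).
Variables (x : label -> {mfun Omega >-> R}) (nu : label ->
  {mfun Omega >-> nat}).
Variable n : nat.

Let G := (\bigcup_(v in [set v | (generation v <= n)%N])
        preimage_set_system [set: Omega] (x v) measurable) `|`
      (\bigcup_(v in [set v | (generation v < n)%N])
        preimage_set_system [set: Omega] (nu v) measurable).

Let T := g_sigma_algebraType G.

Lemma history_measurable E : history x nu n E -> measurable E.
Proof.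
apply: smallest_sub; first exact: sigma_algebra_measurable.
move=> A [] [v _] [B mB <-]; exact: measurable_funP.
Qed.

(* On the history sigma-algebra, labels whose data is not yet revealed get
   constant data; this makes the measurability lemmas stated for arbitrary
   families of measurable maps apply to it. *)
Let pos_restr : exists x' : label -> {mfun T >-> R},
  forall v, (generation v <= n)%N -> forall w, x' v w = x v w.
Proof.
suff h v : exists f : {mfun T >-> R}, (generation v <= n)%N ->
  forall w, f w = x v w.
  by have [f fP] := choice h; exists f.
have [vn|vn] := leqP (generation v) n;
  last by exists (cst 0%R : {mfun T >-> R}).
have mf : measurable_fun [set: T] (x v : T -> R).
  move=> _ B mB; apply: sub_sigma_algebra; left.
  by exists v => //; exists B.
by exists (mfun_Sub (mem_set mf)).
Qed.

Let offspring_restr : exists nu' : label -> {mfun T >-> nat},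
  forall v, (generation v < n)%N -> forall w, nu' v w = nu v w.
Proof.
suff h v : exists f : {mfun T >-> nat}, (generation v < n)%N ->
  forall w, f w = nu v w.
  by have [f fP] := choice h; exists f.
have [vn|vn] := ltnP (generation v) n;
  last by exists (cst 0%N : {mfun T >-> nat}).
have mf : measurable_fun [set: T] (nu v : T -> nat).
  move=> _ B mB; apply: sub_sigma_algebra; right.
  by exists v => //; exists B.
by exists (mfun_Sub (mem_set mf)).
Qed.

Lemma history_population k (L : seq label) :
  history x nu n [set w | population nu k n w = L].
Proof.
have [nu' nu'E] := offspring_restr.
have -> : [set w | population nu k n w = L] =
  [set w : T | population nu' k n w = L].
  apply/seteqP; split => w /= <-; apply: eq_population => v vn; by rewrite nu'E.
exact: (@measurable_population _ T nu' k n L).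
Qed.

Lemma history_config k (U : set (pointMeasure R)) : open U ->
  history x nu n [set w | U (pointSum [seq x v w | v <- population nu k n w])].
Proof.
move=> oU; have [nu' nu'E] := offspring_restr; have [x' x'E] := pos_restr.
have := measurable_config x' nu' k n oU.
congr (measurable _); apply/seteqP; split => w /=.
  rewrite (@eq_population _ _ _ _ nu' nu k n w w); last by move=> v vn;
    rewrite nu'E.
  congr (U (pointSum _)); apply/eq_in_map => v /population_generation vn.
  by rewrite x'E// vn.
rewrite (@eq_population _ _ _ _ nu' nu k n w w); last by move=> v vn;
  rewrite nu'E.
congr (U (pointSum _)); apply/eq_in_map => v /population_generation vn.
by rewrite x'E// vn.
Qed.

End history.

(** * Extinction and survival given the history *)

Section branching.
Context {R : realType} {p : probability nat R} {P : R.-pker R ~> R}.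
Context {mu : nzPointMeasure R} (X : branchingChain p P mu).
Local Notation pmf := Defs.pmf.
Local Notation x := (bc_pos X).
Local Notation nu := (bc_offspring X).
Local Notation k0 := (size (bc_atoms X)).
Local Notation hist := (history (bc_pos X) (bc_offspring X)).
Local Notation pop := (population (bc_offspring X) (size (bc_atoms X))).

Lemma historyI n E F : hist n E -> hist n F -> hist n (E `&` F).
Proof. exact: (@measurableI _ (g_sigma_algebraType _)). Qed.

Lemma aliveE n : alive X n = ~` [set w | pop n w = [::]].
Proof.
apply/seteqP; split => w; rewrite /alive /mkset /config /= diracsE.
  by move=> + pn; rewrite pn big_nil ltxx.
case: (pop n w) => // v s _;
  rewrite /= big_cons diracT (lt_le_trans lte01)// leeDl//.
by apply: sume_ge0 => y _; exact: measure_ge0.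
Qed.

(** The branching property conditions on history events, so events about [Z_n] must be of this kind.
    The admissible [B] form a sigma-algebra containing the open sets. *)
Lemma history_config_nz n (B : set (nzPointMeasure R)) : measurable B ->
  hist n (config X n @^-1` (@nzpm_val R @` B)).
Proof.
set G := [set B : set (nzPointMeasure R) | hist n (config X n @^-1` (@nzpm_val
  R @` B))].
suff : borel `<=` G by apply.
have alive_hist : hist n (alive X n).
  rewrite aliveE; apply: (@measurableC _ (g_sigma_algebraType _)).
  exact: history_population.
apply: smallest_sub.
  split.
  - rewrite /G /= image_set0 preimage_set0;
    exact: (@measurable0 _ (g_sigma_algebraType _)).
  - move=> A; rewrite /G /= => mA.
    rewrite (_ : _ @^-1` _ =
        alive X n `\` config X n @^-1` (@nzpm_val R @` A)).
      exact: (@measurableD _ (g_sigma_algebraType _)).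
    rewrite alive_nz; apply/seteqP; split => w.
      move=> [m [_ nA] nuw]; split; first by exists m.
      by move=> [m' An' n'w]; apply: nA;
        rewrite -(nzpm_val_inj (etrans n'w (esym nuw))).
    by move=> [[m _ nuw] nA]; exists m => //; split=> // Anu; apply: nA;
      exists m.
  - move=> F; rewrite /G /= => mF; rewrite image_bigcup preimage_bigcup.
    apply: (@bigcupT_measurable _ (g_sigma_algebraType _)) => i; exact: mF.
move=> A [U oU <-]; rewrite /G /=.
rewrite (_ : _ @^-1` _ = alive X n `&` config X n @^-1` U).
  by apply: historyI => //; exact: history_config.
rewrite alive_nz; apply/seteqP; split => w.
  by move=> [m Unu nuw]; split; [exists m|rewrite /= -nuw].
by move=> [[m _ nuw]]; rewrite /preimage /= -nuw => Unu; exists m.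
Qed.

(** With the whole line as every target set, the motion kernels contribute factors 1, and the
    integrand of the branching property becomes constant. *)
Lemma prob_offspring n E (s : seq label) (k : label -> nat) : hist n E ->
  uniq s ->
  (forall v, v \in s -> generation v = n) ->
  bc_prob X (E `&` [set w | forall v, v \in s -> nu v w = k v]) =
  bc_prob X E * (\prod_(v <- s) pmf p (k v))%:E.
Proof.
move=> hE us gs.
have := @bc_branching _ _ _ _ X n E s k (fun _ _ =>
  setT) hE us gs (fun _ _ => measurableT).
rewrite (_ : [set w | _] = [set w | forall v, v \in s -> nu v w = k v]);
  last first.
  by apply/seteqP; split => w /= h v /h; [case|].
move=> ->; have mE := history_measurable hE.
transitivity (\int[bc_prob X]_(w in E) (cst (\prod_(v <- s) pmf p (k v))%:E) w).
  apply: eq_integral => w _; congr (_%:E); apply: eq_bigr => v _.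
  by rewrite big1 ?mulr1// => j _; rewrite prob_kernel.
rewrite integral_cst//; exact: muleC.
Qed.

Lemma history_mono n : hist n `<=` hist n.+1.
Proof.
apply: sub_sigma_algebra2 => E [[v /= vn Ev]|[v /= vn Ev]]; [left|right].
  by exists v => //=; exact: ltnW.
by exists v => //=; exact: ltnW.
Qed.

Lemma history_offspring n (s : seq label) (k : label -> nat) :
  (forall v, v \in s -> (generation v < n)%N) ->
  hist n [set w | forall v, v \in s -> nu v w = k v].
Proof.
elim: s => [_|v s IH gs].
  rewrite (_ : [set w | _] = setT);
    first exact: (@measurableT _ (g_sigma_algebraType _)).
  by apply/seteqP; split.
rewrite (_ : [set w | _] = nu v @^-1` [set k v] `&` [set w | forall v,
  v \in s -> nu v w = k v]); last first.
  apply/seteqP; split => w /=.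
    by move=> h; split; [apply: h; rewrite mem_head|move=> u us; apply: h;
      rewrite inE us orbT].
  by move=> [hv h] u; rewrite inE => /predU1P[->|/h].
apply: historyI; last by apply: IH => u us; apply: gs; rewrite inE us orbT.
apply: sub_sigma_algebra; right; exists v; first by apply: gs; rewrite mem_head.
by exists [set k v] => //; rewrite setTI.
Qed.

Hypothesis hC1 : condC1 p.
Local Notation a := (fun l => iter l (genfun p) 0%R).
Local Notation dead n := [set w | pop n w = [::]].

Let pmf_genfun l : \sum_(j <oo) (pmf p j * a l ^+ j)%:E = (a l.+1)%:E.
Proof.
by rewrite genfun_nneseries//; have /andP[-> /ltW] := iter_genfun01 hC1 l.
Qed.

(** Each particle of [L] has a line of descent that dies out within [l] generations with probability
    [a l], independently of the others. Induction on [l] for all [n], [E] and [L]: fixing the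
    offspring numbers of [L] makes generation [n + 1] known. *)
Lemma prob_dead_population l n E L : hist n E -> (forall w, E w ->
  pop n w = L) ->
  bc_prob X (E `&` dead (n + l)) = bc_prob X E * (a l ^+ size L)%:E.
Proof.
elim: l n E L => [|l IH] n E L hE EL.
  rewrite addn0; case: L EL => [|v L] EL.
    by rewrite /= expr0 mule1; congr (bc_prob X _); apply/seteqP;
      split => [w []//|w Ew]; split; [|exact: EL].
  rewrite /= expr0n /= mule0 (_ : _ `&` _ = set0) ?measure0//.
  by rewrite -subset0 => w /= [/EL ->].
(* A point of [E] shows that [L] is duplicate-free and lies in generation [n], as the branching
   property requires. *)
have [->|/set0P[w0 Ew0]] := eqVneq E set0.
  by rewrite set0I measure0 mul0e.
have uL : uniq L by rewrite -(EL _ Ew0) population_uniq.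
have gL v : v \in L -> generation v = n.
  by rewrite -(EL _ Ew0) => /population_generation.
have mdead j : measurable (dead j) by exact: measurable_population.
have a0 j : (0 <= a j)%R by have /andP[] := iter_genfun01 hC1 j.
(* Offspring numbers are prescribed on [s1] and free on [s2], where each label contributes a factor
   [a l.+1]. Induction on [s2] then prescribes one more number at a time. *)
suff key (s1 s2 : seq label) (k : label -> nat) : L = s1 ++ s2 ->
    bc_prob X (E `&` [set w | forall v, v \in s1 ->
      nu v w = k v] `&` dead (n + l.+1)) =
    bc_prob X E * (\prod_(v <- s1) (pmf p (k v) * a l ^+ k v) *
      a l.+1 ^+ size s2)%:E.
  have := key [::] L (fun=> 0%N) erefl; rewrite big_nil mul1r => <-.
  by congr (bc_prob X _); apply/seteqP; split => [w [Ew dw]|w [[Ew _] dw]].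
elim: s2 s1 k => [|v s2 IHs] s1 k Ls.
  (* All offspring numbers are prescribed: generation [n + 1] is [L'], whose size is the sum of the
     [k v], and the induction hypothesis on [l] applies. *)
  rewrite cats0 in Ls; rewrite -Ls expr0 mulr1 addnS -addSn.
  pose L' := [seq child v j | v <- L, j <- iota 0 (k v)].
  rewrite (IH _ _ L'); last 2 first.
  - apply: historyI; first exact: history_mono.
    by apply: history_offspring => v vL; rewrite gL.
  - move=> w [Ew kw] /=; rewrite (EL _ Ew); congr flatten.
    by apply/eq_in_map => v /kw ->.
  rewrite (prob_offspring k hE uL gL) -muleA -EFinM; congr (_ * _%:E).
  rewrite big_split/=; congr (_ * _)%R; rewrite prodrXr; congr (_ ^+ _)%R.
  rewrite size_allpairs_dep sumnE big_map; apply: eq_bigr => v _.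
  by rewrite size_iota.
(* The event is split according to the number [j] of children of [v]; summing [pmf p j * a l ^+ j]
   over [j] yields [a l.+1]. *)
pose kj j u := if u == v then j else k u.
have vs1 : v \notin s1.
  move: uL; rewrite Ls cat_uniq => /and3P[_ /hasPn/(_ v)];
    rewrite mem_head => /(_ isT).
  by [].
have kjs1 j u : u \in s1 -> kj j u = k u.
  by move=> us; rewrite /kj; case: eqP => // uv; rewrite -uv us in vs1.
pose F j := E `&` [set w | forall u, u \in rcons s1 v ->
  nu u w = kj j u] `&` dead (n + l.+1).
have FE j : bc_prob X (F j) =
   bc_prob X E * (\prod_(u <- s1) (pmf p (k u) * a l ^+ k u) *
     a l.+1 ^+ size s2)%:E * (pmf p j * a l ^+ j)%:E.
  rewrite /F IHs; last by rewrite cat_rcons.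
  rewrite -muleA -EFinM; congr (_ * _%:E).
  rewrite big_rcons/= /kj eqxx; rewrite -/(kj j) mulrAC mulrC [in RHS]mulrC;
    congr (_ * _ * _)%R.
  by congr (_ * _)%R; apply: eq_big_seq => u us; have := kjs1 j u us;
    rewrite /kj => ->.
rewrite (_ : _ `&` _ = \bigcup_j F j); last first.
  apply/seteqP; split => [w [[Ew kw] dw]|w [j _ [[Ew kw] dw]]]; last first.
    split => //; split => // u us; rewrite kw ?kjs1// mem_rcons inE us orbT//.
  exists (nu v w) => //; split => //; split => // u;
    rewrite mem_rcons inE => /predU1P[->|us].
    by rewrite /kj eqxx.
  by rewrite kjs1// kw.
have mF j : measurable (F j).
  apply: measurableI => //; apply: measurableI;
    first exact: history_measurable hE.
  apply: (@history_measurable _ _ _ x nu n.+1);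
    apply: history_offspring => u us.
  by rewrite gL// Ls -cat_rcons mem_cat us.
rewrite measure_semi_bigcup//; last 2 first.
- apply/trivIsetP => i j _ _ ij;
  rewrite -subset0 => w [[[_ /(_ v) hi] _] [[_ /(_ v) hj] _]].
  move/eqP: ij; apply; rewrite mem_rcons mem_head in hi hj.
  by have := hi isT; rewrite hj// /kj eqxx.
- exact: bigcup_measurable.
transitivity (\sum_(j <oo) (bc_prob X E * (\prod_(u <- s1) (pmf p (k u) *
  a l ^+ k u) * a l.+1 ^+ size s2)%:E * (pmf p j * a l ^+ j)%:E)).
  by apply: eq_eseriesr => j _; exact: FE.
rewrite -(fineK (fin_num_measure (bc_prob X) _ (history_measurable hE)))
  -EFinM nneseriesZl; last first.
  by move=> j _; rewrite lee_fin mulr_ge0 ?pmf_ge0 ?exprn_ge0//.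
by rewrite pmf_genfun -EFinM -EFinM /= exprSr !mulrA.
Qed.

(** Splits [E] along the countably many possible populations of generation [n]; the extinction
    factor depends only on their common size. *)
Lemma prob_dead n l E j : hist n E -> (forall w, E w -> size (pop n w) = j) ->
  bc_prob X (E `&` dead (n + l)) = bc_prob X E * (a l ^+ j)%:E.
Proof.
move=> hE Ej.
have a0 i : (0 <= a i)%R by have /andP[] := iter_genfun01 hC1 i.
pose F i := if @pickle_inv (seq label) i is Some L then E `&`
  [set w | pop n w = L] else set0.
have hF i : hist n (F i).
  rewrite /F; case: pickle_inv => [L|];
    last exact: (@measurable0 _ (g_sigma_algebraType _)).
  by apply: historyI => //; exact: history_population.
have mF i : measurable (F i) by exact: history_measurable (hF i).
have tF : trivIset setT F.
  apply/trivIsetP => i i' _ _ ii; rewrite -subset0 => w []; rewrite /F.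
  case ei : (@pickle_inv (seq label) i) => [L|//] [_ /= wL];
    case ei' : (@pickle_inv (seq label) i') => [L'|//] [_ /= wL'].
  move/eqP: ii; apply.
  have := @pickle_invK (seq label) i; have := @pickle_invK (seq label) i'.
  by rewrite ei ei' /= -wL -wL' => <- <-.
have mdead i : measurable (dead i) by exact: measurable_population.
have EF : E = \bigcup_i F i.
  apply/seteqP; split => [w Ew|w [i _]]; last by rewrite /F;
    case: pickle_inv => // L [].
  by exists (pickle (pop n w)) => //; rewrite /F pickleK_inv.
rewrite {1}EF setI_bigcupl measure_semi_bigcup//; last 3 first.
- by move=> i; exact: measurableI.
- exact: trivIset_setIr.
- by apply: bigcup_measurable => i _; exact: measurableI.
rewrite {1}EF measure_semi_bigcup//; last exact: bigcup_measurable.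
rewrite muleC -nneseriesZl//; apply: eq_eseriesr => i _.
rewrite [in RHS]muleC; have := hF i; rewrite /F;
  case: pickle_inv => [L|] hFi; last first.
  by rewrite set0I measure0 mul0e.
have [Lj|Lj] := eqVneq (size L) j.
  by apply: (etrans (prob_dead_population l (L := L) hFi _));
    [move=> w []|rewrite Lj].
rewrite (_ : E `&` _ = set0) ?set0I ?measure0 ?mul0e//.
by rewrite -subset0 => w [/Ej + /= wL]; rewrite wL => /eqP; rewrite (negbTE Lj).
Qed.

Lemma pm_count_config n w : pm_count (config X n w) = size (pop n w).
Proof. by rewrite pm_count_pointSum size_map. Qed.

Let mdead j : measurable (dead j).
Proof. exact: measurable_population. Qed.

Lemma prob_alive_history n l E j : hist n E -> (forall w, E w ->
  size (pop n w) = j) ->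
  bc_prob X (E `&` alive X (n + l)) = bc_prob X E * (1 - a l ^+ j)%:E.
Proof.
move=> hE Ej; have mE := history_measurable hE.
have fE : bc_prob X E \is a fin_num by exact: fin_num_measure.
rewrite aliveE -setDE measureD ?ltey_eq ?fE//.
apply: (etrans (congr1 (fun z => bc_prob X E - z) (prob_dead l hE Ej))).
by rewrite EFinB muleBr// mule1.
Qed.

Lemma bc_atoms_size : size (bc_atoms X) = pm_count mu.
Proof.
rewrite -pm_count_pointSum /pm_count /pm_mass; congr (Num.truncn (fine _)).
by rewrite (bc_atomsP X).
Qed.

Lemma prob_alive n : bc_prob X (alive X n) =
  (survival_from p (pm_count mu) n)%:E.
Proof.
have := @prob_alive_history 0 n setT k0 _ _;
  rewrite setTI probability_setT mul1e bc_atoms_size.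
apply; first exact: (@measurableT _ (g_sigma_algebraType _)).
by move=> w _ /=; rewrite size_map size_iota.
Qed.

Lemma aliveLaw_count n l j (A : set (nzPointMeasure R)) : measurable A ->
  A `<=` [set nu' | pm_count nu' = j] ->
  aliveLaw X n l A = aliveLaw X n 0 A * (survival_from p j l)%:E.
Proof.
move=> mA Aj; have hE := @history_config_nz n A mA.
rewrite /aliveLaw (@prob_alive_history n l _ j hE); last first.
  by move=> w [nu' /Aj /= <-]; rewrite -pm_count_config => ->.
rewrite -/(survival_from p j l); congr (bc_prob X _ * _);
  rewrite addn0 alive_nz; apply/esym/setIidl.
by move=> w [nu' _ nuw]; exists nu'.
Qed.

(** After partitioning by the total mass, the survival probability is constant on each piece. Thus
    the lag [l] enters only through a density. *)
Lemma aliveLaw_integral n l (A : set (nzPointMeasure R)) : measurable A ->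
  aliveLaw X n l A = \int[aliveLaw X n 0]_(nu' in A) (survival_from p
    (pm_count (nzpm_val nu')) l)%:E.
Proof.
move=> mA; pose F j := A `&` [set nu' : nzPointMeasure R | pm_count nu' = j].
have mF j : measurable (F j) by apply: measurableI => //;
  exact: measurable_pm_count_eq.
have tF : trivIset setT F.
  by apply/trivIsetP => i j _ _ ij;
    rewrite -subset0 => nu' [[_ /= ci] [_ /= cj]]; move/eqP: ij; apply;
    rewrite -ci.
have AF : A = \bigcup_j F j.
  by apply/seteqP; split => [nu' Anu|nu' [j _ []]//]; exists (pm_count nu').
rewrite [in LHS]AF measure_semi_bigcup//; last exact: bigcup_measurable.
rewrite [in RHS]AF ge0_integral_bigcup//; last 2 first.
- apply: measurable_funTS; apply/measurable_EFinP.
  exact: (measurable_fun_pm_count (survival_from p ^~ l)).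
- by move=> nu' _; rewrite lee_fin survival_from_ge0.
apply: eq_eseriesr => j _;
  apply: (etrans (@aliveLaw_count n l j (F j) _ _)) => //;
  first by move=> nu' [].
transitivity (\int[aliveLaw X n 0]_(nu' in F j) (cst (survival_from p j l)%:E)
  nu').
  by rewrite integral_cst//= muleC.
by apply: eq_integral => nu' /set_mem[_ /= ->].
Qed.

(** The normalising constant is positive, so the default Dirac mass in [condLaw] does not occur. *)
Lemma condLawE n l (A : set (nzPointMeasure R)) : measurable A ->
  condLaw X n l A = aliveLaw X n l A *
    ((survival_from p (pm_count mu) (n + l))^-1)%:E.
Proof.
move=> mA.
have h : (aliveLaw X n l : {measure set _ ->
  \bar R}) setT = (survival_from p (pm_count mu) (n + l))%:E.
  by rewrite -prob_alive; exact: aliveLawT.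
transitivity (mnormalize (aliveLaw X n l) \d_(point : nzPointMeasure R) A);
  first by [].
rewrite /mnormalize h;
  have := survival_from_gt0 hC1 (n + l) (pm_count_gt0 mu);
  set r := (X in (0 < X)%R) => r0.
case: ifPn => [/orP[/eqP|/eqP//]|//].
by rewrite -/r => -[r00]; rewrite r00 ltxx in r0.
Qed.

End branching.

(** * Densities *)

Section density.
Context d (T : measurableType d) (R : realType).

Import HBNNSimple.

(** Simple functions and monotone convergence. The density is described by values on measurable
    sets, so that conditional laws and measures obtained from an existence statement are both
    covered. *)
Lemma ge0_integral_density (Q Q' : {measure set T -> \bar R}) (g : T -> R)
    (f : T -> \bar R) :
  measurable_fun [set: T] g -> (forall x, 0 <= g x)%R ->
  (forall A, measurable A -> Q' A = \int[Q]_(x in A) (g x)%:E) ->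
  measurable_fun [set: T] f -> (forall x, 0 <= f x) ->
  \int[Q']_x f x = \int[Q]_x (f x * (g x)%:E).
Proof.
move=> mg g0 Q'E mf f0.
have mg' : measurable_fun [set: T] (EFin \o g) by exact/measurable_EFinP.
pose f_ := nnsfun_approx measurableT mf.
have cvgf x : (f_ n x)%:E @[n --> \oo] --> f x.
  by apply: cvg_nnsfun_approx.
have ndf x : nondecreasing_seq (fun n => (f_ n x)%:E).
  by move=> m n mn; rewrite lee_fin; exact/lefP/nd_nnsfun_approx.
have h1 : \int[Q']_x (f_ n x)%:E @[n --> \oo] --> \int[Q']_x f x.
  rewrite (_ : \int[Q']_x f x = \int[Q']_x (limn (fun n => (f_ n x)%:E)));
    last first.
    by apply: eq_integral => x _; apply/esym/cvg_lim.
  apply: cvg_monotone_convergence => //.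
  - by move=> n; exact/measurable_EFinP/measurable_funP.
  - by move=> n x _; rewrite lee_fin.
have h2 : \int[Q]_x ((f_ n x)%:E *
  (g x)%:E) @[n --> \oo] --> \int[Q]_x (f x * (g x)%:E).
  rewrite (_ : \int[Q]_x (f x * (g x)%:E) = \int[Q]_x (limn (fun n =>
    (f_ n x)%:E * (g x)%:E))); last first.
    apply: eq_integral => x _; apply/esym/cvg_lim => //.
    by apply: cvgeZr.
  apply: cvg_monotone_convergence => //.
  - by move=> n; apply: emeasurable_funM => //;
    exact/measurable_EFinP/measurable_funP.
  - by move=> n x _; rewrite mule_ge0 ?lee_fin.
  - by move=> x _ m n mn; rewrite lee_wpmul2r ?lee_fin//;
    have := ndf x m n mn; rewrite lee_fin.
rewrite -(cvg_lim _ h1)// -(cvg_lim _ h2)//; congr (limn _); apply/funext => n.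
rewrite integralT_nnsfun sintegralE.
transitivity (\int[Q]_x \sum_(k \in range (f_ n)) ((k *
  \1_(f_ n @^-1` [set k]) x)%:E * (g x)%:E)).
  rewrite ge0_integral_fsum//; last 2 first.
  - by move=> k; apply: emeasurable_funM => //;
    exact/measurable_EFinP/measurable_funM.
  - by move=> k x _; rewrite mule_ge0 ?lee_fin// -lee_fin nnfun_muleindic_ge0.
  apply: eq_fsbigr => k /[!inE] -[x _ kx].
  have k0 : 0 <= k%:E by rewrite -kx lee_fin.
  rewrite Q'E//.
  transitivity (\int[Q]_x (k%:E * ((EFin \o g) \_ (f_ n @^-1` [set k])) x)).
    rewrite ge0_integralZl//; first by rewrite -integral_mkcond.
    - by apply/(measurable_restrictT _ _).1 => //; exact: measurable_funTS.
    - by move=> y _; rewrite patchE; case: ifP => // _; rewrite lee_fin.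
  apply: eq_integral => y _; rewrite patchE EFinM -muleA; congr (_ * _).
  by rewrite indicE; case: ifPn => _; rewrite ?mul1e ?mul0e.
apply: eq_integral => x _; rewrite -ge0_mule_fsuml; last by move=> k;
  rewrite nnfun_muleindic_ge0.
by rewrite fsumEFin// -fimfunE.
Qed.

Lemma Rintegral_density (Q Q' : {measure set T -> \bar R}) (g f : T -> R) :
  measurable_fun [set: T] g -> (forall x, 0 <= g x)%R ->
  (forall A, measurable A -> Q' A = \int[Q]_(x in A) (g x)%:E) ->
  measurable_fun [set: T] f ->
  (\int[Q']_x f x = \int[Q]_x (f x * g x))%R.
Proof.
move=> mg g0 Q'E mf; rewrite /Rintegral; congr fine.
have mf' : measurable_fun [set: T] (EFin \o f) by exact/measurable_EFinP.
rewrite integralE [RHS]integralE; congr (_ - _).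
  rewrite (ge0_integral_density mg g0 Q'E)//; last exact: measurable_funepos.
  apply: eq_integral => x _; rewrite !funeposE/=.
  by rewrite -!EFin_max -EFinM maxr_pMl// mul0r.
rewrite (ge0_integral_density mg g0 Q'E)//; last exact: measurable_funeneg.
apply: eq_integral => x _; rewrite !funenegE/=.
by rewrite -!EFin_max -EFinM maxr_pMl// mul0r mulNr.
Qed.

Section density_measure.
Variables (Q : {measure set T -> \bar R}) (g : T -> R).
Hypothesis mg : measurable_fun [set: T] g.
Hypothesis g0 : forall x, (0 <= g x)%R.

Definition density (A : set T) := \int[Q]_(x in A) (g x)%:E.

Let density0 : density set0 = 0.
Proof. by rewrite /density integral_set0. Qed.

Let density_ge0 A : 0 <= density A.
Proof. by apply: integral_ge0 => x _; rewrite lee_fin. Qed.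

Let density_sigma_additive : semi_sigma_additive density.
Proof.
apply: semi_sigma_additive_nng_induced => [|x]; last by rewrite lee_fin.
exact/measurable_EFinP.
Qed.

HB.instance Definition _ := isMeasure.Build _ _ _ density
  density0 density_ge0 density_sigma_additive.

Lemma density_probability : \int[Q]_x (g x)%:E = 1 ->
  exists Q' : probability T R, forall A, measurable A ->
    Q' A = \int[Q]_(x in A) (g x)%:E.
Proof.
move=> g1; exists (mnormalize density \d_point) => A mA.
transitivity (mnormalize density \d_point A); first by [].
have h : (density : {measure set T -> \bar R}) setT = 1 by exact: g1.
rewrite /mnormalize h.
by case: ifPn => [|_]; rewrite ?orbF ?onee_eq0//= invr1 mule1.
Qed.

End density_measure.

End density.

(** * Limits of survival probabilities *)

Section survival_limits.
Context {R : realType} (p : probability nat R).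
Hypothesis hC1 : condC1 p.
Local Open Scope ring_scope.

Let m : R := fine (mean p).
Let q := survival p.
Let r := survival_from p.

Let m_gt0 : 0 < m. Proof. exact: mean_gt0. Qed.

Let q_gt0 n : 0 < q n. Proof. by have /andP[] := survival_gt0_le1 hC1 n. Qed.

Let a_cvg : q n / m ^+ n @[n --> \oo] --> phi0 p.
Proof. exact: phi0_cvg. Qed.

Let phi0_neq0 : phi0 p != 0.
Proof. by rewrite gt_eqF// phi0_gt0. Qed.

(** With [a l := q l / m ^+ l] the ratio is [a (n + l) / a l * m ^+ n], and [a] has a nonzero
    limit. *)
Lemma survival_ratio_cvg n : q (n + l)%N / q l @[l --> \oo] --> m ^+ n.
Proof.
rewrite (_ : (fun l => _) = fun l =>
  (q (n + l)%N / m ^+ (n + l)) / (q l / m ^+ l) * m ^+ n); last first.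
  apply/funext => l; rewrite exprD; field.
  by rewrite !expf_neq0 ?gt_eqF.
rewrite -[X in _ --> X]mul1r -(divff phi0_neq0); apply: cvgM;
  last exact: cvg_cst.
apply: cvgM; last by apply: cvgV.
exact: (cvg_comp _ _ (cvg_addnl n) a_cvg).
Qed.

(** [bernoulli_le] at [x = q n] squeezes the ratio between [k - k ^ 2 * q n] and [k]. *)
Lemma survival_from_ratio_cvg k : r k n / q n @[n --> \oo] --> (k%:R : R).
Proof.
apply: (@squeeze_cvgr _ _ _ _ (fun n => k%:R - k%:R ^+ 2 * q n) (fun=> k%:R)).
- apply: nearW => n; have /andP[q0 q1] := survival_gt0_le1 hC1 n.
  have /andP[] : 1 - k%:R * q n <= (1 - q n) ^+ k <= 1 - k%:R * q n +
    (k%:R * q n) ^+ 2.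
    by apply: bernoulli_le; rewrite (ltW q0).
  rewrite /r /survival_from (_ : 1 - q n = iter n (genfun p) 0);
    last by rewrite /q /survival subKr.
  set y := _ ^+ k => h1 h2; rewrite ler_pdivlMr// ler_pdivrMr//.
  by apply/andP; split; nra.
- rewrite -[X in _ --> X]subr0 -[X in _ --> _ - X](mulr0 (k%:R ^+ 2)).
  by apply: cvgB; [exact: cvg_cst|apply: cvgMl_tmp; exact: survival_cvg0].
- exact: cvg_cst.
Qed.

Lemma survival_from_shift_ratio_cvg k n :
  r k (n + l)%N / q l @[l --> \oo] --> k%:R * m ^+ n.
Proof.
rewrite (_ : (fun l => _) = fun l =>
  (r k (n + l)%N / q (n + l)%N) * (q (n + l)%N / q l)); last first.
  by apply/funext => l; field; rewrite !gt_eqF.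
apply: cvgM; last exact: survival_ratio_cvg.
exact: (cvg_comp _ _ (cvg_addnl n) (@survival_from_ratio_cvg k)).
Qed.

Lemma survival_from_mean_cvg k : r k n / m ^+ n @[n --> \oo] --> k%:R * phi0 p.
Proof.
rewrite (_ : (fun l => _) = fun l => (r k l / q l) * (q l / m ^+ l));
  last first.
  by apply/funext => l; field; rewrite expf_neq0 ?gt_eqF.
by apply: cvgM => //; exact: survival_from_ratio_cvg.
Qed.

Lemma survival_from_shift_cvg k l : (0 < k)%N ->
  r k (n + l)%N / r k n @[n --> \oo] --> m ^+ l.
Proof.
move=> k0; have kphi : k%:R *
  phi0 p != 0 by rewrite mulf_neq0// pnatr_eq0 -lt0n.
have r_gt0 n : 0 < r k n by exact: survival_from_gt0.
rewrite (_ : (fun n => _) = fun n =>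
  (r k (n + l)%N / m ^+ (n + l)) / (r k n / m ^+ n) * m ^+ l); last first.
  apply/funext => n; rewrite exprD; field.
  by rewrite !expf_neq0 ?gt_eqF.
rewrite -[X in _ --> X]mul1r -(divff kphi); apply: cvgM; last exact: cvg_cst.
apply: cvgM; last by apply: cvgV => //; exact: survival_from_mean_cvg.
exact: (cvg_comp _ _ (cvg_addnr l) (@survival_from_mean_cvg k)).
Qed.

Lemma mean_survival_cvg : m ^+ l / q l @[l --> \oo] --> (phi0 p)^-1.
Proof.
rewrite (_ : (fun l => _) = fun l => (q l / m ^+ l)^-1); last first.
  by apply/funext => l; rewrite invf_div.
exact: cvgV.
Qed.

End survival_limits.

(** * Interchange of the two limits *)

Section interchange.
Context {R : realType}.
Local Open Scope ring_scope.

(* In the application [K n l] arises from [J n] by replacing a probability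
   density by a smaller one of mass [e n l], so the lost mass bounds the error. *)
Lemma cvg_interchange (J : nat -> R) (K e : nat -> nat -> R)
    (Kl el : nat -> R) (M L : R) :
  (forall n l, `|J n - K n l| <= M * (1 - e n l)) ->
  (forall l, K n l @[n --> \oo] --> Kl l) ->
  (forall l, e n l @[n --> \oo] --> el l) ->
  Kl l @[l --> \oo] --> L -> el l @[l --> \oo] --> (1 : R) ->
  J n @[n --> \oo] --> L.
Proof.
move=> JK cK ce cKl cel.
have cM : M * (1 - el l) @[l --> \oo] --> (0 : R).
  rewrite -(mulr0 M); apply: cvgMl_tmp; rewrite -(subrr 1).
  by apply: cvgB => //; exact: cvg_cst.
apply/cvgrPdist_lt => d d0.
have d4 : 0 < d / 4 by rewrite divr_gt0.
move/cvgrPdist_lt : cKl => /(_ _ d4)[N1 _ h1].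
move/cvgrPdist_lt : cM => /(_ _ d4)[N2 _ h2].
(* [l] is fixed first, from the two limits in [l]; only then is [n] taken large for this [l]. *)
pose l := maxn N1 N2.
have {}h1 := h1 l (leq_maxl _ _); have {}h2 := h2 l (leq_maxr _ _).
have cMl : M * (1 - e n l) @[n --> \oo] --> M * (1 - el l).
  by apply: cvgMl_tmp; apply: cvgB; [exact: cvg_cst|exact: ce].
move/cvgrPdist_lt : (cK l) => /(_ _ d4)[N3 _ h3].
move/cvgrPdist_lt : cMl => /(_ _ d4)[N4 _ h4].
exists (maxn N3 N4) => // n /= nN.
have {}h3 := h3 n (leq_trans (leq_maxl _ _) nN).
have {}h4 := h4 n (leq_trans (leq_maxr _ _) nN).
have h5 := JK n l.
move: h1 h2 h3 h4 h5; rewrite /= sub0r normrN !ltr_norml ler_norml.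
move=> /andP[? ?] /andP[? ?] /andP[? ?] /andP[? ?] /andP[? ?].
by apply/andP; split; lra.
Qed.

End interchange.

(** * Iterated limits *)

Section bounded_times_density.
Context d (T : measurableType d) (R : realType) (Q : probability T R).
Implicit Types F g : T -> R.

Lemma ge0_integrable g (x : R) : measurable_fun [set: T] g ->
  (forall x, 0 <= g x)%R ->
  \int[Q]_x (g x)%:E = x%:E -> Q.-integrable setT (EFin \o g).
Proof.
move=> mg g0 gx; apply/integrableP; split; first exact/measurable_EFinP.
under eq_integral do rewrite /= ger0_norm//.
by rewrite gx ltry.
Qed.

Lemma integrable_bounded_mul F g (M : R) : measurable_fun [set: T] F ->
  (forall x, `|F x| <= M)%R -> Q.-integrable setT (EFin \o g) ->
  Q.-integrable setT (EFin \o (fun x => F x * g x)%R).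
Proof.
move=> mF FM ig; have /measurable_EFinP mg := measurable_int _ ig.
apply: (@le_integrable _ _ _ _ _ measurableT _ (EFin \o (fun x => M * g x)%R)).
- by apply/measurable_EFinP; exact: measurable_funM.
- by move=> x _; rewrite /= lee_fin !normrM ler_wpM2r//;
  exact: le_trans (FM x) (ler_norm _).
- by have := integrableZl measurableT M ig.
Qed.

Lemma RintegralZ_bounded F g (M c : R) : measurable_fun [set: T] F ->
  (forall x, `|F x| <= M)%R -> Q.-integrable setT (EFin \o g) ->
  (\int[Q]_x (F x * (g x * c)) = c * \int[Q]_x (F x * g x))%R.
Proof.
move=> mF FM ig; rewrite -RintegralZl//;
  last exact: integrable_bounded_mul FM ig.
by apply: eq_Rintegral => x _; rewrite mulrA mulrC.
Qed.

(** Since [g2 <= g1], the difference of the integrands is at most [M * (g1 - g2)], whose integral is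
    [M] times the lost mass. *)
Lemma ler_norm_Rintegral_densityB F g1 g2 (M x1 x2 : R) :
  measurable_fun [set: T] F -> (forall x, `|F x| <= M)%R ->
  measurable_fun [set: T] g1 -> measurable_fun [set: T] g2 ->
  (forall x, 0 <= g2 x <= g1 x)%R ->
  \int[Q]_x (g1 x)%:E = x1%:E -> \int[Q]_x (g2 x)%:E = x2%:E ->
  (`| \int[Q]_x (F x * g1 x) - \int[Q]_x (F x * g2 x) | <= M * (x1 - x2))%R.
Proof.
move=> mF FM mg1 mg2 g12 I1 I2.
have i1 : Q.-integrable setT (EFin \o g1).
  by apply: (ge0_integrable mg1 _ I1) => x; have /andP[/le_trans h /h] := g12 x.
have i2 : Q.-integrable setT (EFin \o g2).
  by apply: (ge0_integrable mg2 _ I2) => x; have /andP[] := g12 x.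
have iF1 := integrable_bounded_mul mF FM i1.
have iF2 := integrable_bounded_mul mF FM i2.
rewrite -RintegralB//; apply: (le_trans (le_normr_Rintegral measurableT _)).
  by have := integrableB measurableT iF1 iF2.
apply: (@le_trans _ _ (\int[Q]_x (M * (g1 x - g2 x)))%R).
  apply: le_Rintegral => //.
  - by apply: integrable_norm => //; have := integrableB measurableT iF1 iF2.
  - by have := integrableZl measurableT M (integrableB measurableT i1 i2).
  - move=> x _; rewrite -mulrBr normrM [`|g1 x - g2 x|%R]ger0_norm; last first.
      by rewrite subr_ge0; have /andP[] := g12 x.
    by rewrite ler_wpM2r// subr_ge0; have /andP[] := g12 x.
rewrite RintegralZl//; last by have := integrableB measurableT i1 i2.
by rewrite RintegralB// /Rintegral I1 I2.
Qed.

End bounded_times_density.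

Lemma bounded_funM (T : Type) (R : realType) (f g : T -> R) :
  bounded_fun f -> bounded_fun g -> bounded_fun (fun x => f x * g x)%R.
Proof.
move=> [M [_ HM]] [N [_ HN]].
exists ((`|M| + 1) * (`|N| + 1))%R; split => // K ltK x _ /=.
rewrite normrM (le_trans _ (ltW ltK))// ler_pM//.
- by apply: HM => //; rewrite (le_lt_trans (ler_norm _))// ltrDl.
- by apply: HN => //; rewrite (le_lt_trans (ler_norm _))// ltrDl.
Qed.

Lemma continuous_mul (T : topologicalType) (R : realType) (f g : T -> R) :
  continuous f -> continuous g -> continuous (fun x => f x * g x)%R.
Proof. by move=> cf cg x; apply: cvgM; [exact: cf|exact: cg]. Qed.

Section weak_limits.
Context {R : realType} (p : probability nat R).
Hypothesis hC1 : condC1 p.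
Local Notation S := (nzPointMeasure R).
Let m : R := fine (mean p).
Let q := survival p.
Let r := survival_from p.

Let q_gt0 n : (0 < q n)%R.
Proof. by have /andP[] := survival_gt0_le1 hC1 n. Qed.

Let m_gt0 : (0 < m)%R. Proof. exact: mean_gt0. Qed.

(** The total mass is continuous and integer-valued, hence locally constant. *)
Lemma continuous_nz_count (g : nat -> R) : continuous (fun nu : S =>
  g (pm_count nu)).
Proof.
move=> nu; apply: cvg_near_cst; first exact: nbhs_filter.
have := @continuous_pm_count R nu; move=> /cvgrPdist_lt/(_ 1%R ltr01).
apply: (@filterS _ (nbhs nu) (nbhs_filter nu)) => nu';
  rewrite ltr_norml => /andP[h1 h2]; congr g.
move: (pm_count (nzpm_val nu)) (pm_count (nzpm_val nu')) h1 h2 => a b h1 h2.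
have {}h1 : (b < a.+1)%N by rewrite -(ltr_nat R) -natr1; lra.
have {}h2 : (a < b.+1)%N by rewrite -(ltr_nat R) -natr1; lra.
by apply/eqP; rewrite eqn_leq -ltnS h1 -ltnS h2.
Qed.

(** The ratio is the sum of the first [k] powers of [iter l (genfun p) 0], which increases in [l]
    because [q (l + 1) <= m * q l <= q l]. *)
Lemma survival_from_ratio_mono k :
  {homo (fun l => r k l / q l)%R : l l' / (l <= l')%N >-> (l <= l')%R}.
Proof.
apply/nondecreasing_seqP => l; rewrite /r !survival_from_sum.
rewrite mulrAC divff ?mul1r ?gt_eqF ?q_gt0// mulrAC divff ?mul1r ?gt_eqF
  ?q_gt0//.
have /andP[a0 a1] := iter_genfun01 hC1 l.
have aa : (iter l (genfun p) 0 <= iter l.+1 (genfun p) 0)%R.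
  have := survivalS_le hC1 l; have := mean_lt1 hC1; have := q_gt0 l.
  rewrite /q /survival => h1 h2 h3.
  by have : (fine (mean p) * (1 - iter l (genfun p) 0) <= 1 *
    (1 - iter l (genfun p) 0))%R; [rewrite ler_wpM2r ?ltW|lra].
apply: ler_sum => i _; apply: lerXn2r => //; rewrite nnegrE.
exact: le_trans aa.
Qed.

Lemma survival_from_ratio_le k l : (0 <= r k l / q l <= k%:R)%R.
Proof.
rewrite divr_ge0 ?survival_from_ge0 ?(ltW (q_gt0 _))//=.
rewrite -(cvg_lim _ (@survival_from_ratio_cvg _ _ hC1 k))//.
apply: nondecreasing_cvgn_le; first exact: survival_from_ratio_mono.
by apply/cvg_ex; exists k%:R%R; exact: survival_from_ratio_cvg.
Qed.

Let measurable_ratio l : measurable_fun [set: S] (fun nu : S =>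
  r (pm_count nu) l / q l)%R.
Proof. exact: (measurable_fun_pm_count (fun k => r k l / q l)%R). Qed.

Let measurable_count : measurable_fun [set: S] (fun nu : S =>
  (pm_count nu)%:R : R)%R.
Proof. exact: (measurable_fun_pm_count (fun k => k%:R : R)%R). Qed.

(** Monotone convergence allows an infinite limit, so first moments can be computed before they are
    known to be finite. *)
Lemma integral_survival_ratio_cvg (Q : probability S R) :
  \int[Q]_nu (r (pm_count (nzpm_val nu)) l / q l)%:E @[l --> \oo] -->
  \int[Q]_nu (pm_count (nzpm_val nu))%:R%:E.
Proof.
rewrite (_ : \int[Q]_nu (pm_count (nzpm_val nu))%:R%:E =
  \int[Q]_nu (limn (fun l => (r (pm_count (nzpm_val nu)) l / q l)%:E)));
    last first.
  apply: eq_integral => nu _; apply/esym/cvg_lim => //.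
  by apply/cvg_EFin; [exact: nearW|exact: survival_from_ratio_cvg].
apply: cvg_monotone_convergence => //.
- by move=> l; apply/measurable_EFinP.
- by move=> l nu _; rewrite lee_fin;
  have /andP[] := survival_from_ratio_le (pm_count (nzpm_val nu)) l.
- by move=> nu _ a b ab; rewrite lee_fin; exact: survival_from_ratio_mono.
Qed.

(** Dominated convergence: the integrands are bounded by [M * nu(R)], where [M] bounds [F]. *)
Lemma Rintegral_survival_ratio_cvg (Q : probability S R) (F : S -> R) :
  \int[Q]_nu (pm_count (nzpm_val nu))%:R%:E < +oo ->
  measurable_fun [set: S] F -> bounded_fun F ->
  (\int[Q]_nu (F nu * (r (pm_count (nzpm_val nu)) l / q l)))%R @[l --> \oo] -->
  (\int[Q]_nu (F nu * (pm_count (nzpm_val nu))%:R))%R.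
Proof.
move=> Qoo mF bF.
have [M FM] : exists M, forall nu, (`|F nu| <= M)%R.
  by case: bF => M [_ /(_ (M + 1)%R)]; rewrite ltrDl ltr01 => /(_ isT) h;
    exists (M + 1)%R => nu; exact: h.
have M0 : (0 <= M)%R by apply: le_trans (FM point).
have icount : Q.-integrable setT (fun nu =>
  (M * (pm_count (nzpm_val nu))%:R)%:E).
  have : Q.-integrable setT (EFin \o (fun nu : S => (pm_count nu)%:R : R)%R).
    apply/integrableP; split; first exact/measurable_EFinP.
    by under eq_integral do rewrite /= ger0_norm//.
  by move=> h; have := integrableZl measurableT M h.
have [] := @dominated_convergence _ _ _ Q setT measurableT
  (fun l nu => (F nu * (r (pm_count (nzpm_val nu)) l / q l))%:E)
  (fun nu => (F nu * (pm_count (nzpm_val nu))%:R)%:E)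
  (fun nu => (M * (pm_count (nzpm_val nu))%:R)%:E).
- by move=> l; apply/measurable_EFinP; exact: measurable_funM.
- by apply/measurable_EFinP; exact: measurable_funM.
- apply: aeW => nu _; apply/cvg_EFin; first exact: nearW.
  by apply: cvgMl_tmp; exact: survival_from_ratio_cvg.
- exact: icount.
- apply: aeW => nu l _; rewrite lee_fin normrM.
  have /andP[h1 h2] := survival_from_ratio_le (pm_count (nzpm_val nu)) l.
  by rewrite ler_pM// ger0_norm.
move=> i1 _ h; have fi1 := integrable_fin_num measurableT i1.
rewrite /Rintegral; apply: fine_cvg; rewrite fineK//; exact: h.
Qed.

Lemma mean_survival_ecvg : ((m ^+ n / q n)%:E : \bar R) @[n --> \oo] -->
  ((phi0 p)^-1)%:E.
Proof. by apply/cvg_EFin; [exact: nearW|exact: mean_survival_cvg]. Qed.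

(** * Densities and masses of the conditional laws *)

Section conditional_laws.
Context {P : R.-pker R ~> R} {mu : S} (X : branchingChain p P mu).
Let k := pm_count mu.
Let Y n := condLaw X n 0.

Let rk_gt0 n : (0 < r k n)%R.
Proof. exact: survival_from_gt0 (pm_count_gt0 mu). Qed.

Let measurable_r l : measurable_fun [set: S] (fun nu : S => r (pm_count nu) l).
Proof. exact: (measurable_fun_pm_count (fun j => r j l)). Qed.

Lemma condLaw_density n l (A : set S) : measurable A ->
  condLaw X n l A =
  \int[condLaw X n 0]_(nu in A) (r (pm_count (nzpm_val nu)) l *
    (r k n / r k (n + l)))%:E.
Proof.
move=> mA.
(* The unnormalised law has the constant density [r k n] with respect to [Y n]; this form lets
   [ge0_integral_density] apply. *)
have al B : measurable B ->
    (aliveLaw X n 0 : {measure set S ->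
      \bar R}) B = \int[Y n]_(nu in B) ((fun=> r k n) nu)%:E.
  move=> mB; transitivity (\int[Y n]_(nu in B) (cst (r k n)%:E) nu); last by [].
  have YE : (Y n : {measure set S ->
    \bar R}) B = aliveLaw X n 0 B * ((r k (n + 0))^-1)%:E by exact: condLawE.
  rewrite integral_cst// YE addn0 muleCA -EFinM divff ?mule1//.
  by rewrite gt_eqF.
rewrite condLawE// aliveLaw_integral// integral_mkcond.
have mf : measurable_fun [set: S] ((fun nu : S => (r (pm_count nu) l)%:E) \_ A).
  apply: (iffLR (measurable_restrictT _ mA)); apply: measurable_funTS.
  exact/measurable_EFinP.
have f0 (nu : S) : 0 <= ((fun nu : S => (r (pm_count nu) l)%:E) \_ A) nu.
  by rewrite patchE; case: ifP => // _; rewrite lee_fin survival_from_ge0.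
rewrite (ge0_integral_density (measurable_cst _) (fun=> ltW (rk_gt0 n)) al)//.
rewrite -ge0_integralZr//; last 3 first.
- by apply: emeasurable_funM => //; exact/measurable_EFinP.
- by move=> nu _; apply: mule_ge0; [exact: f0|rewrite lee_fin;
  exact: ltW (rk_gt0 n)].
- by rewrite lee_fin invr_ge0 ltW.
rewrite [RHS]integral_mkcond; apply: eq_integral => nu _; rewrite !patchE.
by case: ifP => _; rewrite ?mul0e// -!EFinM mulrA.
Qed.

(** Expresses that the density in [condLaw_density] integrates to one. *)
Lemma condLaw_survival_mass n l :
  \int[Y n]_nu (r (pm_count (nzpm_val nu)) l)%:E = (r k (n + l) / r k n)%:E.
Proof.
have := condLaw_density n l measurableT; rewrite probability_setT => h.
have c0 : (0 < r k n / r k (n + l))%R by rewrite divr_gt0.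
have h2 : \int[Y n]_nu (r (pm_count (nzpm_val nu)) l)%:E * (r k n / r k (n +
  l))%:E = 1.
  rewrite -ge0_integralZr//.
  - exact/measurable_EFinP.
  - by move=> nu _; rewrite lee_fin survival_from_ge0.
  - by rewrite lee_fin ltW.
rewrite -[LHS]mule1 -[1](_ : (r k n / r k (n + l))%:E * (r k (n +
  l) / r k n)%:E = 1); last first.
  by rewrite -EFinM; congr _%:E; field; rewrite !gt_eqF.
by rewrite muleA h2 mul1e.
Qed.

(** Divide the survival mass by [q l] and let [l] grow, with monotone convergence on the integral
    side. *)
Lemma condLaw_count_mass n :
  \int[Y n]_nu (pm_count (nzpm_val nu))%:R%:E = (k%:R * m ^+ n / r k n)%:E.
Proof.
have h := @integral_survival_ratio_cvg (Y n).
rewrite -(cvg_lim _ h)//; apply/cvg_lim => //.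
rewrite (_ : (fun l => _) = fun l => (r k (n + l) / q l / r k n)%:E);
  last first.
  apply/funext => l; under eq_integral do rewrite EFinM.
  rewrite ge0_integralZr//.
  - rewrite condLaw_survival_mass -EFinM; congr _%:E; field.
    by rewrite !gt_eqF.
  - exact/measurable_EFinP.
  - by move=> nu _; rewrite lee_fin survival_from_ge0.
  - by rewrite lee_fin invr_ge0 ltW.
apply/cvg_EFin; first exact: nearW.
by apply: cvgMr_tmp; exact: survival_from_shift_ratio_cvg.
Qed.

End conditional_laws.

Section yaglom.
Context {P : R.-pker R ~> R} (X : forall mu : S, branchingChain p P mu).
Variable Q : probability S R.
Hypothesis hQ : yaglom_limit X Q.

(** The survival probability is a bounded continuous function of the configuration, hence a test
    function for the Yaglom limit. Any starting configuration gives the same value; [point] is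
    used. *)
Lemma yaglom_survival_mass l :
  \int[Q]_nu (r (pm_count (nzpm_val nu)) l)%:E = (m ^+ l)%:E.
Proof.
have b : bounded_fun (fun nu : S => r (pm_count nu) l).
  by apply: bounded_fun01 => nu; rewrite survival_from_ge0// survival_from_le1.
have := hQ point (@continuous_nz_count (fun j => r j l)) b.
rewrite (_ : (fun n => _) = fun n =>
  r (pm_count (point : S)) (n + l)%N / r (pm_count (point : S)) n)%R;
  last first.
  by apply/funext => n; rewrite /Rintegral condLaw_survival_mass.
move=> h; have := @survival_from_shift_cvg _ _ hC1 _ l (pm_count_gt0 (point :
  S)).
move=> /(cvg_unique _ h) => <-//.
rewrite /Rintegral fineK//; apply: integrable_fin_num => //.
apply: bounded_integrable => //;
  exact: (measurable_fun_pm_count (fun j => r j l)).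
Qed.

(** Same passage to the limit in [l] as for the conditional laws; it makes [phi0 p * nu(R)] a
    probability density. *)
Lemma yaglom_count_mass :
  \int[Q]_nu (pm_count (nzpm_val nu))%:R%:E = ((phi0 p)^-1)%:E.
Proof.
have h := @integral_survival_ratio_cvg Q.
rewrite -(cvg_lim _ h)//; apply/cvg_lim => //.
rewrite (_ : (fun l => _) = fun l => (m ^+ l / q l)%:E); last first.
  apply/funext => l; under eq_integral do rewrite EFinM.
  rewrite ge0_integralZr//.
  - by rewrite yaglom_survival_mass -EFinM.
  - by apply/measurable_EFinP;
    exact: (measurable_fun_pm_count (fun j => r j l)).
  - by move=> nu _; rewrite lee_fin survival_from_ge0.
  - by rewrite lee_fin invr_ge0 ltW.
exact: mean_survival_ecvg.
Qed.

End yaglom.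

(** * The inner limits and the common outer limit *)

Section main.
Context {P : R.-pker R ~> R} (X : forall mu : S, branchingChain p P mu).
Variable Qmin : probability S R.
Hypothesis hQ : yaglom_limit X Qmin.
Variable mu : S.
Let k := pm_count mu.
Local Notation Y n := (condLaw (X mu) n 0).

Let rk_gt0 n : (0 < r k n)%R.
Proof. exact: survival_from_gt0 (pm_count_gt0 mu). Qed.

Let k_gt0 : (0 < k%:R :> R)%R.
Proof. by rewrite ltr0n; exact: pm_count_gt0. Qed.

Let phi0_pos : (0 < phi0 p)%R. Proof. exact: phi0_gt0. Qed.

Let measurable_phi (g : nat -> R) : measurable_fun [set: S] (fun nu : S =>
  g (pm_count nu)).
Proof. exact: measurable_fun_pm_count. Qed.

(** Candidate for the inner limit in [l]; its mass is one by [condLaw_count_mass]. *)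
Let Q1_ex n : exists Q : probability S R, forall A, measurable A ->
  Q A = \int[Y n]_(nu in A) ((pm_count (nzpm_val nu))%:R *
    (r k n / (k%:R * m ^+ n)))%:E.
Proof.
apply: density_probability.
- exact: (measurable_phi (fun j => j%:R * (r k n / (k%:R * m ^+ n)))%R).
- by move=> nu; rewrite mulr_ge0// divr_ge0 ?mulr_ge0 ?exprn_ge0 ?ltW.
under eq_integral do rewrite EFinM.
rewrite ge0_integralZr//; last 2 first.
- by apply/measurable_EFinP.
- by rewrite lee_fin divr_ge0 ?mulr_ge0 ?exprn_ge0 ?ltW.
rewrite condLaw_count_mass -EFinM; congr _%:E; field.
by rewrite expf_neq0 ?gt_eqF// gt_eqF.
Qed.

(** Candidate for the inner limit in [n]; its mass is one by [yaglom_survival_mass]. *)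
Let Q2_ex l : exists Q : probability S R, forall A, measurable A ->
  Q A = \int[Qmin]_(nu in A) (r (pm_count (nzpm_val nu)) l / m ^+ l)%:E.
Proof.
apply: density_probability.
- exact: (measurable_phi (fun j => r j l / m ^+ l)%R).
- by move=> nu; rewrite divr_ge0 ?survival_from_ge0// exprn_ge0// ltW.
under eq_integral do rewrite EFinM.
rewrite ge0_integralZr//; last 3 first.
- by apply/measurable_EFinP; exact: (measurable_phi (fun j => r j l)).
- by move=> nu _; rewrite lee_fin survival_from_ge0.
- by rewrite lee_fin invr_ge0 exprn_ge0// ltW.
rewrite (yaglom_survival_mass hQ) -EFinM divff//.
by rewrite expf_neq0// gt_eqF.
Qed.

Let Qinf_ex : exists Q : probability S R, forall A, measurable A ->
  Q A = \int[Qmin]_(nu in A) ((pm_count (nzpm_val nu))%:R * phi0 p)%:E.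
Proof.
apply: density_probability.
- exact: (measurable_phi (fun j => j%:R * phi0 p)%R).
- by move=> nu; rewrite mulr_ge0// ltW.
under eq_integral do rewrite EFinM.
rewrite ge0_integralZr//; last 2 first.
- by apply/measurable_EFinP.
- by rewrite lee_fin ltW.
by rewrite (yaglom_count_mass hQ) -EFinM mulVf// gt_eqF.
Qed.

Lemma iterated_limits : exists (Q1 Q2 : nat -> probability S R)
    (Qinf : probability S R),
  [/\ forall n, weak_cvg (condLaw (X mu) n) (Q1 n),
      weak_cvg Q1 Qinf,
      forall l, weak_cvg (fun n => condLaw (X mu) n l) (Q2 l),
      weak_cvg Q2 Qinf &
      forall A, measurable A ->
        Qinf A = \int[Qmin]_(nu in A) ((pm_count (nzpm_val nu))%:R *
          phi0 p)%:E].
Proof.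
have [Q1 Q1E] := choice Q1_ex.
have [Q2 Q2E] := choice Q2_ex.
have [Qinf QinfE] := Qinf_ex.
exists Q1, Q2, Qinf.
have irY n l : (Y n).-integrable setT (EFin \o (fun nu : S =>
  r (pm_count nu) l)).
  apply: (ge0_integrable (measurable_phi (fun j =>
    r j l)) _ (condLaw_survival_mass (X mu) n l)).
  by move=> nu; exact: survival_from_ge0.
have icY n : (Y n).-integrable setT (EFin \o (fun nu : S =>
  (pm_count nu)%:R : R)%R).
  by apply: (ge0_integrable _ _ (condLaw_count_mass (X mu) n)).
have irQ l : Qmin.-integrable setT (EFin \o (fun nu : S => r (pm_count nu) l)).
  apply: (ge0_integrable (measurable_phi (fun j =>
    r j l)) _ (yaglom_survival_mass hQ l)).
  by move=> nu; exact: survival_from_ge0.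
have icQ : Qmin.-integrable setT (EFin \o (fun nu : S =>
  (pm_count nu)%:R : R)%R).
  by apply: (ge0_integrable _ _ (yaglom_count_mass hQ)).
have bd (F : S -> R) : bounded_fun F -> exists M, forall nu, (`|F nu| <= M)%R.
  case=> M [_ /(_ (M + 1)%R)]; rewrite ltrDl ltr01 => /(_ isT) h.
  by exists (M + 1)%R => nu; exact: h.
have mn0 n : (m ^+ n != 0)%R by rewrite expf_neq0// gt_eqF.
have rE n l (F : S -> R) : measurable_fun [set: S] F -> bounded_fun F ->
    (\int[condLaw (X mu) n l]_nu F nu =
     (r k n / r k (n + l)) * \int[Y n]_nu (F nu *
       r (pm_count (nzpm_val nu)) l))%R.
  move=> mF /bd[M FM].
  rewrite (Rintegral_density (measurable_phi (fun j =>
    r j l * (r k n / r k (n + l)))%R) _ (condLaw_density (X mu) n l))//.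
    exact: RintegralZ_bounded FM (irY n l).
  by move=> nu; rewrite mulr_ge0 ?survival_from_ge0// divr_ge0// ltW.
have Q1I n (F : S -> R) : measurable_fun [set: S] F -> bounded_fun F ->
    (\int[Q1 n]_nu F nu =
     (r k n / (k%:R * m ^+ n)) * \int[Y n]_nu (F nu *
       (pm_count (nzpm_val nu))%:R))%R.
  move=> mF /bd[M FM].
  rewrite (Rintegral_density (measurable_phi (fun j =>
    j%:R * (r k n / (k%:R * m ^+ n)))%R) _ (Q1E n))//.
    exact: RintegralZ_bounded FM (icY n).
  by move=> nu; rewrite mulr_ge0// divr_ge0 ?mulr_ge0 ?exprn_ge0 ?ltW.
have Q2I l (F : S -> R) : measurable_fun [set: S] F -> bounded_fun F ->
    (\int[Q2 l]_nu F nu =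
     (m ^+ l)^-1 * \int[Qmin]_nu (F nu * r (pm_count (nzpm_val nu)) l))%R.
  move=> mF /bd[M FM].
  rewrite (Rintegral_density (measurable_phi (fun j =>
    r j l / m ^+ l)%R) _ (Q2E l))//.
    exact: RintegralZ_bounded FM (irQ l).
  by move=> nu; rewrite divr_ge0 ?survival_from_ge0// exprn_ge0// ltW.
have QinfI (F : S -> R) : measurable_fun [set: S] F -> bounded_fun F ->
    (\int[Qinf]_nu F nu = phi0 p * \int[Qmin]_nu (F nu *
      (pm_count (nzpm_val nu))%:R))%R.
  move=> mF /bd[M FM].
  rewrite (Rintegral_density (measurable_phi (fun j =>
    j%:R * phi0 p)%R) _ QinfE)//.
    exact: RintegralZ_bounded FM icQ.
  by move=> nu; rewrite mulr_ge0// ltW.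
have ratioI (Q : probability S R) l (F : S ->
  R) : measurable_fun [set: S] F -> bounded_fun F ->
    Q.-integrable setT (EFin \o (fun nu : S => r (pm_count nu) l)) ->
    (\int[Q]_nu (F nu * (r (pm_count (nzpm_val nu)) l / q l)) =
    (q l)^-1 * \int[Q]_nu (F nu * r (pm_count (nzpm_val nu)) l))%R.
  by move=> mF /bd[M FM] iQ; exact: RintegralZ_bounded FM iQ.
(* A bounded continuous [F] times the survival probability is again bounded and continuous, so the
   Yaglom limit applies to the product. *)
have w2in l : weak_cvg (fun n => condLaw (X mu) n l) (Q2 l).
  move=> F cF bF; have mF := continuous_nz_measurable cF.
  rewrite Q2I//; under eq_fun do rewrite rE//.
  apply: cvgM.
    rewrite (_ : (fun n => _) = fun n => (r k (n + l) / r k n)^-1)%R;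
      last first.
      by apply/funext => n; rewrite invf_div.
    by apply: cvgV => //; exact: survival_from_shift_cvg (pm_count_gt0 mu).
  apply: (hQ mu).
    exact: (continuous_mul cF (@continuous_nz_count (fun j => r j l))).
  apply: bounded_funM => //; apply: bounded_fun01 => nu.
  by rewrite survival_from_ge0// survival_from_le1.
have w2out : weak_cvg Q2 Qinf.
  move=> F cF bF; have mF := continuous_nz_measurable cF.
  rewrite QinfI//.
  (* Inserting [q l] lets the prefactor and the integral converge separately. *)
  rewrite (_ : (fun l => _) = fun l =>
    ((m ^+ l / q l)^-1 * \int[Qmin]_nu (F nu *
    (r (pm_count (nzpm_val nu)) l / q l)))%R); last first.
    by apply/funext => l; rewrite Q2I// ratioI//; field; rewrite mn0 gt_eqF.
  apply: cvgM.
    rewrite -[X in _ --> X]invrK; apply: cvgV; first by rewrite invr_eq0 gt_eqF.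
    exact: mean_survival_cvg.
  by apply: Rintegral_survival_ratio_cvg => //;
    rewrite (yaglom_count_mass hQ) ltry.
have w1in n : weak_cvg (condLaw (X mu) n) (Q1 n).
  move=> F cF bF; have mF := continuous_nz_measurable cF.
  rewrite Q1I//.
  rewrite (_ : (fun l => _) = fun l =>
    ((r k n * (r k (n +
    l) / q l)^-1) * \int[Y n]_nu (F nu *
    (r (pm_count (nzpm_val nu)) l / q l)))%R); last first.
    by apply/funext => l; rewrite rE// ratioI//; field; rewrite !gt_eqF.
  apply: cvgM.
    apply: cvgMl_tmp; apply: cvgV; first by rewrite mulf_neq0// gt_eqF.
    exact: survival_from_shift_ratio_cvg.
  by apply: Rintegral_survival_ratio_cvg => //; rewrite condLaw_count_mass ltry.
have w1out : weak_cvg Q1 Qinf.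
  move=> F cF bF; have mF := continuous_nz_measurable cF;
    have [M FM] := bd F bF.
  (* [e n l] is the mass that remains when [nu(R)] is replaced by [r (nu(R)) l / q l] in the density
     of [Q1 n]; [el l] is its limit in [n]. *)
  pose e n l : R := (r k (n + l) / (k%:R * m ^+ n * q l))%R.
  pose el l : R := (phi0 p * (m ^+ l / q l))%R.
  have ce l : e n l @[n --> \oo] --> el l.
    rewrite (_ : (fun n => _) = fun n =>
      (r k (n + l) / m ^+ (n + l) * (m ^+ l / (k%:R * q l)))%R); last first.
      by apply/funext => n; rewrite /e exprD; field; rewrite !mn0 !gt_eqF.
    rewrite (_ : el l = k%:R * phi0 p * (m ^+ l / (k%:R * q l)))%R; last first.
      by rewrite /el; field; rewrite !gt_eqF.
    apply: cvgMr_tmp.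
    exact: (cvg_comp _ _ (cvg_addnr l) (@survival_from_mean_cvg _ _ hC1 k)).
  have cel : el l @[l --> \oo] --> (1 : R)%R.
    rewrite -(@mulfV _ (phi0 p)) ?gt_eqF//; apply: cvgMl_tmp.
    exact: mean_survival_cvg.
  (* The measure of mass [e n l] is [e n l] times the conditional law, so its limits in [n] and then
     in [l] come from the other order, [w2in] and [w2out]. *)
  apply: (@cvg_interchange _ _ (fun n l =>
    e n l * \int[condLaw (X mu) n l]_nu F nu)%R e
    (fun l => el l * \int[Q2 l]_nu F nu)%R el M) => //; last 2 first.
  - by move=> l; apply: cvgM => //; exact: w2in.
  - by rewrite -[X in _ --> X]mul1r; apply: cvgM => //; exact: w2out.
  move=> n l; set c : R := (r k n / (k%:R * m ^+ n))%R.
  have c0 : (0 < c)%R by rewrite divr_gt0// mulr_gt0// exprn_gt0.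
  have g2E : (e n l * \int[condLaw (X mu) n l]_nu F nu =
      \int[Y n]_nu (F nu * (r (pm_count (nzpm_val nu)) l * (c / q l))))%R.
    rewrite rE// (RintegralZ_bounded _ mF FM (irY n l)) mulrA; congr (_ * _)%R.
    by rewrite /e /c; field; rewrite mn0 !gt_eqF.
  have g1E : (\int[Q1 n]_nu F nu =
    \int[Y n]_nu (F nu * ((pm_count (nzpm_val nu))%:R * c)))%R.
    by rewrite Q1I// (RintegralZ_bounded _ mF FM (icY n)).
  rewrite g1E g2E; apply: ler_norm_Rintegral_densityB => //.
  - exact: (measurable_phi (fun j => j%:R * c)%R).
  - exact: (measurable_phi (fun j => r j l * (c / q l))%R).
  - move=> nu; have /andP[h1 h2] := survival_from_ratio_le (pm_count (nzpm_val
    nu)) l.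
    rewrite (_ : r _ l * (c / q l) =
      r (pm_count (nzpm_val nu)) l / q l * c)%R; last by rewrite mulrA mulrAC.
    by rewrite mulr_ge0 ?(ltW c0)//= ler_pM2r.
  - by rewrite -[LHS]Q1E// probability_setT.
  - under eq_integral do rewrite EFinM.
    rewrite ge0_integralZr//; last 3 first.
    + by apply/measurable_EFinP; exact: (measurable_phi (fun j => r j l)).
    + by move=> nu _; rewrite lee_fin survival_from_ge0.
    + by rewrite lee_fin divr_ge0// ltW.
    rewrite condLaw_survival_mass -EFinM; congr _%:E.
    by rewrite /e /c -/k; field; rewrite mn0 !gt_eqF.
by split.
Qed.

End main.

End weak_limits.

(** * Uniqueness of the iterated limit and its Laplace functional *)

Lemma weak_cvg_unique (R : realType)
    (Q_ : nat -> probability (nzPointMeasure R) R)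
    (Q Q' : probability (nzPointMeasure R) R) :
  weak_cvg Q_ Q -> weak_cvg Q_ Q' ->
  forall F : nzPointMeasure R -> R, continuous F -> bounded_fun F ->
    (\int[Q]_nu F nu = \int[Q']_nu F nu)%R.
Proof. by move=> cQ cQ' F cF bF;
  exact: cvg_unique (cQ F cF bF) (cQ' F cF bF). Qed.

(** Two choices of inner limits give the same integrals of bounded continuous functions, hence the
    same real sequences along the outer index; [weak_determined] then identifies the outer
    limits. *)
Lemma iterated_weak_cvg_unique (R : realType)
    (Q_ : nat -> nat -> probability (nzPointMeasure R) R)
    (Q Q' : probability (nzPointMeasure R) R) :
  iterated_weak_cvg Q_ Q -> iterated_weak_cvg Q_ Q' -> Q ≡μ Q'.
Proof.
move=> [Qin [cin cQ]] [Qin' [cin' cQ']]; apply: weak_determined => F cF bF.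
apply: (cvg_unique _ (cQ F cF bF)) => //.
rewrite (_ : (fun n => _) = fun n => (\int[Qin' n]_nu F nu)%R);
  first exact: cQ'.
by apply/funext => n; exact: weak_cvg_unique (cin n) (cin' n) F cF bF.
Qed.

Lemma measurable_pm_int (R : realType) (h : R -> R) : bdd_borel_nonneg h ->
  measurable_fun [set: nzPointMeasure R] (fun nu : nzPointMeasure R =>
    pm_int nu h).
Proof.
move=> [mh _ h0].
apply: (measurableT_comp (fine_measurable measurableT)).
apply: (measurable_pm_integral (h := EFin \o h)); first exact/measurable_EFinP.
by move=> x; rewrite lee_fin.
Qed.

Theorem corollary2p10 (R : realType) (p : probability nat R)
    (P : R.-pker R ~> R)
    (X : forall mu : nzPointMeasure R, branchingChain p P mu)
    (Qmin : probability (nzPointMeasure R) R)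
    (hC1 : condC1 p) (hC2 : condC2 p) (hC3 : condC3 P)
    (hQmin : yaglom_limit X Qmin) :
  forall mu : nzPointMeasure R,
  exists Qinf : probability (nzPointMeasure R) R,
    [/\ iterated_weak_cvg (fun n l => condLaw (X mu) n l) Qinf,
        forall Q : probability (nzPointMeasure R) R,
          iterated_weak_cvg (fun n l => condLaw (X mu) n l) Q -> Q ≡μ Qinf
      & forall h : R -> R, bdd_borel_nonneg h ->
          laplace Qinf h = (phi0 p)%:E *
            \int[Qmin]_nu (pm_mass (nzpm_val nu) * (expR (- pm_int (nzpm_val nu) h))%:E)] /\
    iterated_weak_cvg (fun l n => condLaw (X mu) n l) Qinf.
Proof.
move=> mu; have [Q1 [Q2 [Qinf [w1 w1inf w2 w2inf QinfE]]]] := iterated_limits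
  hC1 hQmin mu.
have it1 : iterated_weak_cvg (fun n l => condLaw (X mu) n l) Qinf by exists Q1.
exists Qinf; split; last by exists Q2.
split => // [Q itQ|h bh]; first exact: iterated_weak_cvg_unique itQ it1.
have me : measurable_fun [set: nzPointMeasure R]
    (fun nu : nzPointMeasure R => (expR (- pm_int nu h))%:E).
  apply/measurable_EFinP; apply: measurableT_comp => //.
  by apply: measurableT_comp => //; exact: measurable_pm_int.
have mc (c : R) : measurable_fun [set: nzPointMeasure R]
    (fun nu : nzPointMeasure R => (pm_count nu)%:R * c)%R.
  exact: (measurable_fun_pm_count (fun j => j%:R * c)%R).
have phi_ge0 := ltW (phi0_gt0 hC1).
(* The Laplace formula is a change of density from [Qinf] to [Qmin], applied to the nonnegative
   measurable function [exp(- nu(h))]. *)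
rewrite /laplace (ge0_integral_density (mc _) _ QinfE)//; last first.
  by move=> nu; rewrite mulr_ge0.
rewrite -ge0_integralZl//.
- by apply: eq_integral => nu _; rewrite pm_massE -!EFinM; congr _%:E; ring.
- apply: emeasurable_funM => //.
  rewrite (_ : (fun x => _) = EFin \o (fun nu : nzPointMeasure R =>
    (pm_count nu)%:R : R)%R); last first.
    by apply/funext => nu; rewrite pm_massE.
  by apply/measurable_EFinP;
    exact: (measurable_fun_pm_count (fun j => j%:R : R)%R).
- by move=> nu _; rewrite mule_ge0// ?lee_fin ?expR_ge0// pm_massE.
Qed.
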